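(* Let $A$ be a bijective skew $PBW$ extension of a ring $R$ such that $R$ is left Noetherian, left regular and $PSF$. Then $A$ is $PSF$.
   Context: Rings are associative with identity, not necessarily commutative; $\mathbb{N}=\{0,1,2,\dots\}$. Let $R$ and $A$ be rings. $A$ is a skew $PBW$ extension of $R$, written $A=\sigma(R)\langle x_1,\dots,x_n\rangle$, if: (i) $R\subseteq A$; (ii) there are finitely many elements $x_1,\dots,x_n\in A$ such that $A$ is a free left $R$-module with basis $\mathrm{Mon}(A):=\{x^\alpha=x_1^{\alpha_1}\cdots x_n^{\alpha_n}\mid \alpha=(\alpha_1,\dots,\alpha_n)\in\mathbb{N}^n\}$ (with $x_1^0\cdots x_n^0:=1$); (iii) for every $1\le i\le n$ and $r\in R-\{0\}$ there exists $c_{i,r}\in R-\{0\}$ such that $x_ir-c_{i,r}x_i\in R$; (iv) for every $1\le i,j\le n$ there exists $c_{i,j}\in R-\{0\}$ such that $x_jx_i-c_{i,j}x_ix_j\in R+Rx_1+\cdots+Rx_n$. Then for every $i$ there are an injective ring endomorphism $\sigma_i:R\to R$ (with $\sigma_i(r)=c_{i,r}$ for $r\neq 0$) and a $\sigma_i$-derivation $\delta_i:R\to R$ such that $x_ir=\sigma_i(r)x_i+\delta_i(r)$ for all $r\in R$. $A$ is called bijective if $\sigma_i$ is bijective for every $1\le i\le n$ and $c_{i,j}$ is invertible for all $1\le i<j\le n$. A ring is left regular if every finitely generated left module over it has finite projective dimension. A ring $B$ is $PSF$ if each finitely generated projective (left) $B$-module $P$ is stably free, i.e. $P\oplus B^s\cong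 B^t$ for some $s,t\in\mathbb{N}$. *)

(* Defs.v *)
From HB Require Import structures.
From mathcomp Require Import all_boot all_algebra.

Set Implicit Arguments.
Unset Strict Implicit.
Unset Printing Implicit Defensive.

Import GRing.Theory.
Local Open Scope ring_scope.

(* Rings are [pzRingType]s (the zero ring is allowed) and left modules are
   [lmodType]s. *)

Section Modules.

Variable R : pzRingType.

Definition fin_generated (M : lmodType R) : Prop :=
  exists (k : nat) (g : 'I_k -> M),
    forall m : M, exists c : 'I_k -> R, m = \sum_(i < k) c i *: g i.

Definition projective (P : lmodType R) : Prop :=
  forall (M N : lmodType R) (g : {linear M -> N}) (f : {linear P -> N}),
    (forall y : N, exists x : M, g x = y) ->
    exists h : {linear P -> M}, forall p : P, g (h p) = f p.

Definition exact_at (U V W : lmodType R)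
    (f : {linear U -> V}) (g : {linear V -> W}) : Prop :=
  forall v : V, g v = 0 <-> exists u : U, f u = v.

(* There is an exact sequence 0 -> P_n -> ... -> P_0 -> M -> 0 with all P_i
   projective; it is indexed by all of nat and padded with zero modules. *)
Definition projdim_le (M : lmodType R) (n : nat) : Prop :=
  exists (P : nat -> lmodType R)
         (d : forall i : nat, {linear P i.+1 -> P i})
         (eps : {linear P 0 -> M}),
    [/\ forall i : nat, projective (P i),
        forall m : M, exists p : P 0, eps p = m,
        exact_at (d 0) eps,
        forall i : nat, exact_at (d i.+1) (d i)
      & forall i : nat, (n < i)%N -> forall p : P i, p = 0].

Definition finite_projdim (M : lmodType R) : Prop :=
  exists n : nat, projdim_le M n.

Definition stably_free (P : lmodType R) : Prop :=
  exists (s t : nat) (f : {linear (P * 'rV[R]_s)%type -> 'rV[R]_t}),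
    bijective f.

Definition left_ideal (I : R -> Prop) : Prop :=
  [/\ I 0, forall a b : R, I a -> I b -> I (a + b)
    & forall r a : R, I a -> I (r * a)].

End Modules.

Definition left_noetherian (R : pzRingType) : Prop :=
  forall I : R -> Prop, left_ideal I ->
    exists (k : nat) (g : 'I_k -> R),
      forall a : R, I a <-> exists c : 'I_k -> R, a = \sum_(i < k) c i * g i.

Definition left_regular (R : pzRingType) : Prop :=
  forall M : lmodType R, fin_generated M -> finite_projdim M.

Definition PSF (R : pzRingType) : Prop :=
  forall P : lmodType R, fin_generated P -> projective P -> stably_free P.

Section SkewPBW.

(* The inclusion of R in A is an injective ring morphism [iota]; A is a left
   R-module through r . a := iota r * a. *)
Variables (R A : pzRingType) (iota : {rmorphism R -> A}).
Variables (n : nat) (x : 'I_n -> A).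

(* The factors are multiplied in increasing order of i. *)
Definition pbw_mon (alpha : {ffun 'I_n -> nat}) : A :=
  \prod_(i < n) x i ^+ alpha i.

Definition pbw_spanning : Prop :=
  forall a : A, exists (s : seq {ffun 'I_n -> nat})
                       (c : {ffun 'I_n -> nat} -> R),
    a = \sum_(alpha <- s) iota (c alpha) * pbw_mon alpha.

Definition pbw_independent : Prop :=
  forall (s : seq {ffun 'I_n -> nat}) (c : {ffun 'I_n -> nat} -> R),
    uniq s -> \sum_(alpha <- s) iota (c alpha) * pbw_mon alpha = 0 ->
    forall alpha, alpha \in s -> c alpha = 0.

Definition pbw_scalar_coef (i : 'I_n) (r c : R) : Prop :=
  c <> 0 /\ exists r0 : R, x i * iota r - iota c * x i = iota r0.

Definition pbw_comm_coef (i j : 'I_n) (c : R) : Prop :=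
  c <> 0 /\
  exists (r0 : R) (r : 'I_n -> R),
    x j * x i - iota c * x i * x j = iota r0 + \sum_(k < n) iota (r k) * x k.

Definition skew_pbw_extension : Prop :=
  [/\ injective iota,
      pbw_spanning /\ pbw_independent,
      forall (i : 'I_n) (r : R), r <> 0 -> exists c : R, pbw_scalar_coef i r c
    & forall i j : 'I_n, exists c : R, pbw_comm_coef i j c].

(* In a skew PBW extension 1 and x_i are left R-independent, so this identity
   determines sigma and delta; it forces sigma to be an injective ring
   endomorphism, with sigma r = c_{i,r}, and delta to be a sigma-derivation. *)
Definition pbw_sigma_delta (i : 'I_n) (sigma delta : R -> R) : Prop :=
  forall r : R, x i * iota r = iota (sigma r) * x i + iota (delta r).

Definition invertible (c : R) : Prop :=
  exists d : R, d * c = 1 /\ c * d = 1.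

(* For i < j the coefficient c_{i,j} is unique by independence, so the
   existential below speaks of the c_{i,j} of the extension. *)
Definition bijective_skew_pbw_extension : Prop :=
  [/\ skew_pbw_extension,
      forall i : 'I_n, exists sigma delta : R -> R,
        pbw_sigma_delta i sigma delta /\ bijective sigma
    & forall i j : 'I_n, (i < j)%N ->
        exists c : R, pbw_comm_coef i j c /\ invertible c].

End SkewPBW.

(* Main.v *)
(* Order the monomials x^a of A degree-lexicographically.  Reordering a word in
   the x_i only costs invertible scalars and words of lower degree, so the
   associated graded object of A has rank one over R in each degree a, and x_i
   acts bijectively from degree a to degree a + U_(i).

   Call a filtered A-module M tame, with bound N, if its filtration pieces are
   finitely generated over R and if x_i acts bijectively on the graded pieces
   from degree a to degree a + U_(i) whenever a_i >= N.  Every finitely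
   generated A-module has such a filtration, because R is left Noetherian and a
   monotone family of submodules of R^k indexed by N^n is eventually constant in
   each coordinate.  Such an M is controlled by the finitely many degrees in the
   box [0, N]^n.

   Let b be the first degree of the box where M does not vanish.  Then
   V = F_b M is an honest R-submodule of M, and M has a strict cover by a
   filtered free module, with generators in the degrees of the box, whose kernel
   K is again tame with bound N, vanishes before b, and has in degree b a
   syzygy of V.  By regularity, iterating this makes V projective; then V is
   stably free over R, and after adding a free summand to M one can choose the
   cover so that K also vanishes in degree b.  Once the whole box is exhausted
   the kernel is 0.  Along 0 -> K -> A^m -> M -> 0 with M projective, K is
   projective, and M is stably free if K is. *)
Require Import Defs.
From HB Require Import structures.
From mathcomp Require Import all_boot all_order all_algebra.
From mathcomp Require Import boolp mpoly.

Set Implicit Arguments.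
Unset Strict Implicit.
Unset Printing Implicit Defensive.

Import GRing.Theory Order.Theory.
Local Open Scope ring_scope.

(** * Submodules and projective modules *)

Section Submodule.

Variables (S : pzRingType) (M : lmodType S) (W : M -> Prop).

Definition submodule : Prop :=
  [/\ W 0, forall u v, W u -> W v -> W (u + v)
    & forall (r : S) v, W v -> W (r *: v)].

Hypothesis hW : submodule.

(** The proof of [submodule] is an argument of the type, so that the module structure declared below
    can be found from the type alone. *)
Definition submod of submodule := {v : M | `[< W v >]}.
Local Notation V := (submod hW).

HB.instance Definition _ := [isSub of V for sval].
HB.instance Definition _ := [Choice of V by <:].

Lemma submod_subproof : GRing.submod_closed (fun v => `[< W v >]).
Proof.
case: hW => W0 WD WZ; split=> [|r u v /asboolP Wu /asboolP Wv]; apply/asboolP=> //.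
by apply: WD => //; apply: WZ.
Qed.

HB.instance Definition _ :=
  GRing.SubChoice_isSubLmodule.Build S M (fun v => `[< W v >]) V submod_subproof.

Lemma submodP (v : V) : W (val v).
Proof. by case: v => v Wv; apply/asboolP. Qed.

Definition submod_elt v (Wv : W v) : V := Sub v (asboolT Wv).

End Submodule.
Section Linear.

Variables (S : pzRingType).
Implicit Types (U V M N P Q : lmodType S).

Definition mk_linear U V (f : U -> V) (lin_f : linear f) : {linear U -> V} :=
  HB.pack f (GRing.isLinear.Build S U V *:%R f lin_f).

Definition surj U V (f : U -> V) : Prop := forall v, exists u, f u = v.

Lemma bij_linear_inv U V (f : {linear U -> V}) : injective f -> surj f ->
  exists g : {linear V -> U}, cancel f g /\ cancel g f.
Proof.
move=> fI /choice[g gK].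
have lin_g : linear g by move=> r u v; apply: fI; rewrite linearP !gK.
by exists (mk_linear lin_g); split=> [u|v] /=; [apply: fI; rewrite gK | rewrite gK].
Qed.

Lemma ker_submodule U V (f : {linear U -> V}) : submodule (fun u => f u = 0).
Proof.
split=> [|u v fu fv|r u fu]; first exact: linear0.
- by rewrite linearD fu fv addr0.
- by rewrite linearZ /= fu scaler0.
Qed.

Definition kermod U V (f : {linear U -> V}) : lmodType S :=
  submod (ker_submodule f).

Definition corestr U V (f : {linear U -> V}) (W : V -> Prop)
    (hW : submodule W) (fW : forall u, W (f u)) : U -> submod hW :=
  fun u => submod_elt hW (fW u).

Lemma corestr_linear U V (f : {linear U -> V}) (W : V -> Prop)
    (hW : submodule W) (fW : forall u, W (f u)) : linear (corestr hW fW).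
Proof. by move=> r u v; apply: val_inj; rewrite /= linearP. Qed.

Lemma projective_section P V (f : {linear P -> V}) :
  projective V -> surj f -> exists h : {linear V -> P}, cancel h f.
Proof.
move=> prV f_surj; have lin_id : linear (fun v : V => v) by [].
by have [h hK] := prV _ _ f (mk_linear lin_id) f_surj; exists h.
Qed.

Lemma projective_retract P Q (i : {linear Q -> P}) (r : {linear P -> Q}) :
  cancel i r -> projective P -> projective Q.
Proof.
move=> iK prP M N g f g_surj.
have lin_fr : linear (f \o r) by move=> a u v; rewrite /= !linearP.
have [h hK] := prP _ _ g (mk_linear lin_fr) g_surj.
have lin_hi : linear (h \o i) by move=> a u v; rewrite /= !linearP.
by exists (mk_linear lin_hi) => q; rewrite /= hK /= iK.
Qed.

Lemma projective_prod P Q :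
  projective P -> projective Q -> projective (P * Q)%type.
Proof.
move=> prP prQ M N g f g_surj.
have lin1 : linear (fun p : P => f (p, 0)).
  move=> a u v; rewrite -linearP; congr (f _); apply/pair_equal_spec.
  by split=> //=; rewrite scaler0 addr0.
have lin2 : linear (fun q : Q => f (0, q)).
  move=> a u v; rewrite -linearP; congr (f _); apply/pair_equal_spec.
  by split=> //=; rewrite scaler0 addr0.
have [h1 h1K] := prP _ _ g (mk_linear lin1) g_surj.
have [h2 h2K] := prQ _ _ g (mk_linear lin2) g_surj.
have lin_h : linear (fun pq : P * Q => h1 pq.1 + h2 pq.2).
  by move=> a u v /=; rewrite !linearP scalerDr addrACA.
exists (mk_linear lin_h) => -[p q] /=.
rewrite linearD h1K h2K /= -linearD; congr (f _).
by apply/pair_equal_spec; rewrite addr0 add0r.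
Qed.

Definition lincomb M (m : nat) (g : 'I_m -> M) (v : 'rV[S]_m) : M :=
  \sum_j v 0 j *: g j.

Lemma lincomb_linear M m (g : 'I_m -> M) : linear (lincomb g).
Proof.
move=> a u v; rewrite /lincomb scaler_sumr -big_split /=.
by apply: eq_bigr => j _; rewrite !mxE scalerDl scalerA.
Qed.

Lemma linear_rV M m (f : {linear 'rV[S]_m -> M}) v :
  f v = lincomb (fun j => f (delta_mx 0 j)) v.
Proof.
rewrite {1}(row_sum_delta v) linear_sum; apply: eq_bigr => j _.
by rewrite linearZ.
Qed.

Lemma projective_rV m : projective 'rV[S]_m.
Proof.
move=> M N g f g_surj.
have [y yK] := choice (fun j => g_surj (f (delta_mx 0 j))).
exists (mk_linear (lincomb_linear y)) => v.
rewrite [RHS]linear_rV /= /lincomb linear_sum; apply: eq_bigr => j _.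
by rewrite linearZ /= yK.
Qed.

Lemma projective_zero V : (forall v : V, v = 0) -> projective V.
Proof.
move=> V0 M N g f g_surj; have lin0 : linear (fun _ : V => 0 : M).
  by move=> a u v; rewrite scaler0 addr0.
by exists (mk_linear lin0) => v; rewrite /= (V0 v) !linear0.
Qed.

Lemma stably_free_zero V : (forall v : V, v = 0) -> stably_free V.
Proof.
move=> V0; exists 0%N, 0%N.
have lin2 : linear (fun p : V * 'rV[S]_0 => p.2) by [].
exists (mk_linear lin2); exists (fun w => (0, w)) => [[v w]|w] //=.
by rewrite (V0 v).
Qed.

(* Unlike stable freeness, this passes from a syzygy of [M] to [M] with no
   projectivity assumption on [M]. *)
Definition sfree_if_proj V : Prop := projective V -> stably_free V.

(** If [M] is projective, [f] splits and S^m is the direct sum of [M] and its kernel K, so K is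
    projective. From K + S^s = S^t one gets M + S^t = M + K + S^s = S^(m+s). *)
Lemma sfree_if_proj_ker m M (f : {linear 'rV[S]_m -> M}) :
  surj f -> sfree_if_proj (kermod f) -> sfree_if_proj M.
Proof.
move=> f_surj sK prM; have [h hK] := projective_section prM f_surj.
have p_ker v : f (v - h (f v)) = 0 by rewrite linearB hK subrr.
have lin_p : linear (fun v => v - h (f v)).
  by move=> a u v; rewrite (linearP f) (linearP h) scalerBr opprD addrACA.
have lin_r := corestr_linear (f := mk_linear lin_p) (ker_submodule f) p_ker.
have prK : projective (kermod f).
  apply: (projective_retract (i := val) (r := mk_linear lin_r)) (projective_rV (m := m)).
  move=> u; apply: val_inj; rewrite /= (submodP u).
  by rewrite linear0 subr0.
have [s [t [e [e0 eK0 e0K]]]] := sK prK.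
have [E [eK e'K]] := bij_linear_inv (can_inj eK0) (fun w => ex_intro _ (e0 w) (e0K w)).
exists t, (m + s)%N.
have lin_F : linear (fun p : M * 'rV[S]_t =>
    row_mx (h p.1 + val (E p.2).1) (E p.2).2).
  move=> a [u w] [u' w'] /=.
  rewrite (linearP h) (linearP E) /= scale_row_mx add_row_mx; congr row_mx.
  by rewrite scalerDr addrACA.
exists (mk_linear lin_F).
pose r := corestr (f := mk_linear lin_p) (ker_submodule f) p_ker.
exists (fun w => (f (lsubmx w), e (r (lsubmx w), rsubmx w))).
- move=> [u w] /=; rewrite row_mxKl row_mxKr linearD hK (submodP (E w).1) addr0.
  congr (_, _); rewrite -[RHS]e'K; congr (e _).
  rewrite [RHS]surjective_pairing; congr (_, _); apply: val_inj => /=.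
  by rewrite linearD hK (submodP (E w).1) addr0 addrC addKr.
- move=> w /=; rewrite eK /= addrC subrK.
  by rewrite hsubmxK.
Qed.

(** Allows a free summand to be added to [M] before a cover is chosen. *)
Lemma sfree_if_proj_prod s M :
  sfree_if_proj (M * 'rV[S]_s)%type -> sfree_if_proj M.
Proof.
move=> sMs prM.
have [a [b [e [e' eK e'K]]]] := sMs (projective_prod prM (projective_rV (m := s))).
exists (s + a)%N, b.
have lin_F : linear (fun p : M * 'rV[S]_(s + a) =>
    e ((p.1, lsubmx p.2), rsubmx p.2)).
  move=> r [u w] [u' w'] /=; rewrite -linearP; congr (e _).
  by rewrite !linearP.
exists (mk_linear lin_F).
exists (fun z => ((e' z).1.1, row_mx (e' z).1.2 (e' z).2)) => [[u w]|z] /=.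
  by rewrite eK /= hsubmxK.
by rewrite row_mxKl row_mxKr -!surjective_pairing e'K.
Qed.

End Linear.

(** * Projective dimension *)

Section ProjectiveDimension.

Variable S : pzRingType.
Implicit Types (V K P Q F : lmodType S).

(** Recursion on syzygies, so that one step of a resolution can be removed and compared with any
    other cover. *)
Fixpoint pdim_le (d : nat) V : Prop :=
  if d is e.+1 then
    exists (K P : lmodType S) (i : {linear K -> P}) (f : {linear P -> V}),
      [/\ projective P, injective i, exact_at i f, surj f & pdim_le e K]
  else projective V.

Lemma pdim_le_iso d V V' (f : {linear V -> V'}) :
  injective f -> surj f -> pdim_le d V -> pdim_le d V'.
Proof.
move=> f_inj f_surj; have [g [fK gK]] := bij_linear_inv f_inj f_surj.
case: d => [|d] /=; first exact: projective_retract gK.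
move=> [K [P [i [h [prP i_inj ex_ih h_surj pdK]]]]].
have lin_fh : linear (f \o h) by move=> a u v; rewrite /= !linearP.
exists K, P, i, (mk_linear lin_fh); split=> //= [p|v].
  rewrite -ex_ih; split=> [fh|hp]; last by rewrite /= hp linear0.
  by apply: f_inj; rewrite linear0; apply: fh.
by have [p hp] := h_surj (g v); exists p; rewrite /= hp gK.
Qed.

Lemma pdim_le_prod d V Q :
  projective Q -> pdim_le d V -> pdim_le d (V * Q)%type.
Proof.
move=> prQ; case: d => [|d] /=; first by move=> prV; apply: projective_prod.
move=> [K [P [i [h [prP i_inj ex_ih h_surj pdK]]]]].
have lin_i : linear (fun k => (i k, 0 : Q)).
  by move=> a u v; rewrite linearP; apply/pair_equal_spec; rewrite /= scaler0 addr0.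
have lin_h : linear (fun p : P * Q => (h p.1, p.2)).
  by move=> a u v; rewrite linearP.
exists K, (P * Q)%type, (mk_linear lin_i), (mk_linear lin_h).
split=> //=; first exact: projective_prod.
- by move=> k k' [/i_inj].
- move=> [p q] /=; split=> [[/ex_ih[k ki] ->]|[k [<- <-]]]; first by exists k; rewrite ki.
  by congr (_, _); apply/ex_ih; exists k.
- by move=> [v q]; have [p <-] := h_surj v; exists (p, q).
Qed.

(** For positive [d], the cover of the product is restricted to the kernel of its map onto [Q]. This
    kernel is a retract of [P] because [Q] is projective, and the syzygy [K] does not change. *)
Lemma pdim_le_prod_inv d V Q :
  projective Q -> pdim_le d (V * Q)%type -> pdim_le d V.
Proof.
have lin1 : linear (fun v : V => (v, 0 : Q)).
  by move=> a u v; apply/pair_equal_spec; rewrite /= scaler0 addr0.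
have lin2 : linear (fun p : V * Q => p.1) by [].
move=> prQ; case: d => [|d] /=.
  exact: (projective_retract (i := mk_linear lin1) (r := mk_linear lin2)).
move=> [K [P [i [h [prP i_inj ex_ih h_surj pdK]]]]].
have lin_h2 : linear (fun p : P => (h p).2) by move=> a u v; rewrite linearP.
have lin_h1 : linear (fun p : kermod (mk_linear lin_h2) => (h (val p)).1).
  by move=> a u v; rewrite /= linearP.
have h2_surj : surj (mk_linear lin_h2).
  by move=> q; have [p hp] := h_surj (0, q); exists p; rewrite /= hp.
have [t tK] := projective_section prQ h2_surj.
pose h2 := mk_linear lin_h2.
have ri p : h2 (p - t (h2 p)) = 0 by rewrite linearB tK subrr.
have lin_p : linear (fun p => p - t (h2 p)).
  by move=> a u v; rewrite (linearP h2) (linearP t) scalerBr opprD addrACA.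
have lin_r := corestr_linear (f := mk_linear lin_p) (ker_submodule h2) ri.
have hi k : h (i k) = 0 by apply/ex_ih; exists k.
have ker_i k : h2 (i k) = 0 by rewrite /= hi.
have lin_i := corestr_linear (ker_submodule h2) ker_i.
exists K, (kermod h2), (mk_linear lin_i), (mk_linear lin_h1); split=> //.
- apply: (projective_retract (i := val) (r := mk_linear lin_r)) prP => u.
  apply: val_inj; rewrite /= [X in t X](_ : _ = 0) ?linear0 ?addr0 //.
  exact: (submodP u).
- by move=> k k' /(congr1 val) /i_inj.
- move=> p; split=> [hp|[k <-]]; last by rewrite /= hi.
  have /ex_ih[k ki] : h (val p) = 0.
    by rewrite [h _]surjective_pairing; congr (_, _); [exact: hp | exact: (submodP p)].
  by exists k; apply: val_inj.
- move=> v; have [p hp] := h_surj (v, 0).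
  have kp : h2 p = 0 by rewrite /= hp.
  by exists (submod_elt (ker_submodule h2) kp); rewrite /= hp.
Qed.

(* Schanuel: [P * K] is isomorphic to [F * K0], where [K0] is the kernel of the
   cover of [V] by [P] provided by the hypothesis. *)
Lemma pdim_le_syzygy d V K F (j : {linear K -> F}) (f : {linear F -> V}) :
    projective F -> injective j -> exact_at j f -> surj f ->
  pdim_le d.+1 V -> pdim_le d K.
Proof.
move=> prF j_inj ex_jf f_surj.
move=> [K0 [P [i [h [prP i_inj ex_ih h_surj pdK0]]]]].
(* [a] and [b] lift each of the two covers of [V] through the other. *)
have [a aK] := prF _ _ h f h_surj.
have [b bK] := prP _ _ f h f_surj.
have fj k : f (j k) = 0 by apply/ex_jf; exists k.
have hi k : h (i k) = 0 by apply/ex_ih; exists k.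
have ker1 (kq : K0 * F) : f (kq.2 - b (i kq.1 + a kq.2)) = 0.
  by rewrite linearB bK linearD hi add0r aK subrr.
(* [u] is the K-component of the isomorphism from K0 * F to K * P; its P-component is p = i k0 + a
   q. The inverse reads q = j u + b p and i k0 = p - a q. *)
have /choice[u uK] (kq : K0 * F) : exists k, j k = kq.2 - b (i kq.1 + a kq.2).
  exact/ex_jf.
have lin_u : linear (fun kq => (u kq, i kq.1 + a kq.2)).
  move=> r x y; rewrite -[RHS]/(r *: u x + u y, r *: (i x.1 + a x.2) + (i y.1 + a y.2)).
  have lin_ia : i (r *: x + y).1 + a (r *: x + y).2
       = r *: (i x.1 + a x.2) + (i y.1 + a y.2).
    by rewrite (linearP i) (linearP a) scalerDr addrACA.
  congr (_, _) => //; apply: j_inj.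
  rewrite (linearP j) !uK lin_ia (linearP b) /= scalerBr opprD addrACA.
  by [].
apply: (pdim_le_prod_inv prP); have := pdim_le_prod prF pdK0.
apply: (pdim_le_iso (f := mk_linear lin_u)) => /=.
- move=> [k q] [k' q'] /= [/(congr1 j)]; rewrite !uK /= => + e; rewrite e.
  by move=> /addIr eq; move: e; rewrite eq => /addIr/i_inj ->.
- move=> [k p].
  have /ex_ih[k0 k0i] : h (p - a (j k + b p)) = 0.
    by rewrite linearB aK linearD fj add0r bK subrr.
  exists (k0, j k + b p); congr (_, _) => /=; last by rewrite k0i subrK.
  by apply: j_inj; rewrite uK /= k0i subrK addrK.
Qed.

(** The offset two is slack: the recursion stops at a kernel inside the first term known to vanish,
    instead of at the last projective term. *)
Lemma projdim_le_pdim_le V d : projdim_le V d -> pdim_le d.+2 V.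
Proof.
move=> [P [D [eps [prP eps_surj ex0 exS P0]]]].
have pd_ker e i : (forall j, (i + e < j)%N -> forall p : P j, p = 0) ->
    pdim_le e (kermod (D i)).
  elim: e i => [|e IHe] i Pz /=.
    by apply: projective_zero => k; apply: val_inj; apply: Pz; rewrite addn0.
  have DD p : D i (D i.+1 p) = 0 by apply/exS; exists p.
  exists (kermod (D i.+1)), (P i.+2), val,
    (mk_linear (corestr_linear (ker_submodule (D i)) DD)); split=> //.
  - exact: val_inj.
  - move=> p; split=> [/(congr1 val) /= Dp|[k <-]].
      by exists (submod_elt (ker_submodule (D i.+1)) Dp).
    by apply: val_inj; rewrite /= (submodP k).
  - by move=> k; have /exS[p pk] := submodP k; exists p; apply: val_inj.
  - by apply: IHe => j; rewrite addSnnS; apply: Pz.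
have eD p : eps (D 0 p) = 0 by apply/ex0; exists p.
exists (kermod eps), (P 0), val, eps; split=> //; first exact: val_inj.
  move=> p; split=> [ep|[k <-]]; last exact: (submodP k).
  by exists (submod_elt (ker_submodule eps) ep).
exists (kermod (D 0)), (P 1), val,
  (mk_linear (corestr_linear (ker_submodule eps) eD)); split=> //.
- exact: val_inj.
- move=> p; split=> [/(congr1 val) /= Dp|[k <-]].
    by exists (submod_elt (ker_submodule (D 0)) Dp).
  by apply: val_inj; rewrite /= (submodP k).
- by move=> k; have /ex0[p pk] := submodP k; exists p; apply: val_inj.
- by apply: pd_ker => j; rewrite add0n; apply: P0.
Qed.

End ProjectiveDimension.

(** * Spans over the ring of scalars *)

Section ScalarSpan.

Variables (R A : pzRingType) (iota : {rmorphism R -> A}).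

Section OneModule.

Variable M : lmodType A.
Implicit Types (X W : M -> Prop) (s : seq M).

(** [R] acts on the A-module [M] through [iota], so that R-submodules are predicates on [M] itself
    and mix freely with the action of [A]. *)
Inductive rspan X : M -> Prop :=
| rspan0 : rspan X 0
| rspan_step r y v : X y -> rspan X v -> rspan X (iota r *: y + v).

Definition rsubmodule W : Prop :=
  [/\ W 0, forall u v, W u -> W v -> W (u + v)
    & forall r v, W v -> W (iota r *: v)].

Lemma rsubmoduleN W v : rsubmodule W -> W v -> W (- v).
Proof.
by case=> _ _ WZ Wv; rewrite -scaleN1r -(rmorph1 iota) -rmorphN; apply: WZ.
Qed.

Lemma rsubmoduleB W u v : rsubmodule W -> W u -> W v -> W (u - v).
Proof.
by move=> hW Wu Wv; case: (hW) => _ WD _; apply: WD => //; apply: rsubmoduleN.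
Qed.

Lemma rsubmodule_sum W I (r : seq I) (F : I -> M) : rsubmodule W ->
  (forall i, W (F i)) -> W (\sum_(i <- r) F i).
Proof.
by move=> [W0 WD _] WF; elim/big_ind: _ => //.
Qed.

Lemma rspan_sub X W : rsubmodule W -> (forall y, X y -> W y) ->
  forall v, rspan X v -> W v.
Proof.
by move=> [W0 WD WZ] XW v; elim=> // r y u Xy _ Wu; apply: WD => //; apply/WZ/XW.
Qed.

Lemma rspan_submodule X : rsubmodule (rspan X).
Proof.
split; first exact: rspan0.
- move=> u v; elim=> [|r y w Xy _ IH] sv; first by rewrite add0r.
  by rewrite -addrA; apply: rspan_step => //; apply: IH.
- move=> r v; elim=> [|a y w Xy _ IH]; first by rewrite scaler0; apply: rspan0.
  by rewrite scalerDr scalerA -rmorphM; apply: rspan_step.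
Qed.

Lemma rspan_in X y : X y -> rspan X y.
Proof.
move=> Xy; rewrite -[y]addr0 -{1}[y]scale1r -(rmorph1 iota).
by apply: rspan_step => //; apply: rspan0.
Qed.

Lemma rspan_sum X v : rspan X v -> forall (k : nat) (g : 'I_k -> M),
  (forall y, X y -> exists c : 'I_k -> R, y = \sum_j iota (c j) *: g j) ->
  exists c : 'I_k -> R, v = \sum_j iota (c j) *: g j.
Proof.
move=> sv k g Xg; elim: sv => [|r y w /Xg[c ->] _ [d ->]].
  by exists (fun=> 0); rewrite big1 // => j _; rewrite rmorph0 scale0r.
exists (fun j => r * c j + d j); rewrite scaler_sumr -big_split /=.
by apply: eq_bigr => j _; rewrite rmorphD rmorphM scalerDl scalerA.
Qed.

Lemma rspan_seq s v : rspan (fun y => y \in s) v ->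
  exists c : 'I_(size s) -> R, v = \sum_j iota (c j) *: s`_j.
Proof.
move/rspan_sum; apply=> y /(nthP 0)[j js <-].
exists (fun i => (i == Ordinal js)%:R); rewrite (bigD1 (Ordinal js)) //=.
rewrite eqxx rmorph1 scale1r big1 ?addr0 // => i /negPf ->.
by rewrite rmorph0 scale0r.
Qed.

Definition rfingen W : Prop :=
  exists s, forall v, W v -> rspan (fun y => y \in s) v.

Lemma rspan_cons y s v : rspan (fun z => z \in y :: s) v ->
  exists r w, rspan (fun z => z \in s) w /\ v = iota r *: y + w.
Proof.
have [s0 sD sZ] := rspan_submodule (fun z => z \in s).
elim=> [|r z u].
  by exists 0, 0; rewrite rmorph0 scale0r addr0.
rewrite inE => zs _ [a [w [sw ->]]]; have [->|zy] := eqVneq z y.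
  by exists (r + a), w; rewrite rmorphD scalerDl addrA.
exists a, (iota r *: z + w); split; last by rewrite addrCA.
by apply: rspan_step => //; move: zs; rewrite (negPf zy).
Qed.

Lemma rspan_sub_seq X Y : (forall v, X v -> rspan Y v) ->
  forall v, rspan X v -> rspan Y v.
Proof. by move=> XY v; apply: rspan_sub => //; apply: rspan_submodule. Qed.

Lemma rspan_mono X Y v : (forall v, X v -> Y v) -> rspan X v -> rspan Y v.
Proof. by move=> XY; apply: rspan_sub_seq => y /XY; apply: rspan_in. Qed.

Hypothesis hnoeth : left_noetherian R.

(** Induction on the generators of the ambient span. The coefficients of the first generator [y] in
    elements of [W] form a left ideal [I]. Lifts to [W] of generators of [I] reduce an element of
    [W] to one in the span of the remaining generators, where induction applies. *)
Lemma rfingen_noetherian W : rsubmodule W -> rfingen W ->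
  exists s, (forall y, y \in s -> W y) /\
    (forall v, W v -> rspan (fun y => y \in s) v).
Proof.
move=> hW [s]; elim: s W hW => [|y s IHs] W hW Ws.
  exists [::]; split=> // v /Ws; elim=> [|r y w //]; exact: rspan0.
have [W0 WD WZ] := hW; set sp := rspan (fun z => z \in s) in IHs.
have [s0 sD sZ] : rsubmodule sp by apply: rspan_submodule.
have [s' [s'W s'P]] : exists s', (forall y, y \in s' -> W y /\ sp y) /\
    (forall v, W v /\ sp v -> rspan (fun y => y \in s') v).
  apply: IHs => [|v []//]; split=> //.
  - by move=> u v [Wu su] [Wv sv]; split; [apply: WD | apply: sD].
  - by move=> r v [Wv sv]; split; [apply: WZ | apply: sZ].
pose I r := exists2 w, sp w & W (iota r *: y + w).
have [k [g gP]] : exists (k : nat) (g : 'I_k -> R), forall a,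
    I a <-> exists c : 'I_k -> R, a = \sum_(i < k) c i * g i.
  apply: hnoeth; split.
  - by exists 0; rewrite // rmorph0 scale0r addr0.
  - move=> a b [u su Wu] [v sv Wv]; exists (u + v); first exact: sD.
    by rewrite rmorphD scalerDl addrACA; apply: WD.
  - move=> r a [u su Wu]; exists (iota r *: u); first exact: sZ.
    by rewrite rmorphM -scalerA -scalerDr; apply: WZ.
have /choice[h hP] i : exists w, sp w /\ W (iota (g i) *: y + w).
  suff /gP[w sw Ww] : exists c : 'I_k -> R, g i = \sum_(i < k) c i * g i by exists w.
  exists (fun j => (j == i)%:R); rewrite (bigD1 i) //= eqxx mul1r big1 ?addr0 //.
  by move=> j /negPf ->; rewrite mul0r.
pose l := [seq iota (g i) *: y + h i | i <- enum 'I_k] ++ s'.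
exists l; split.
  move=> z; rewrite mem_cat => /orP[/mapP[i _ ->]|/s'W[]//].
  by have [] := hP i.
move=> v Wv; have [r [w [sw vE]]] := rspan_cons (Ws v Wv).
have [|c rE] := (gP r).1; first by exists w; rewrite // -vE.
pose t z := is_true (z \in l).
have [t0 tD tZ] := rspan_submodule t; rewrite -/(rspan t v).
pose u := \sum_i iota (c i) *: (iota (g i) *: y + h i).
have -> : v = u + (v - u) by rewrite addrC subrK.
have tu : rspan t u.
  apply: rsubmodule_sum; first exact: rspan_submodule.
  move=> i; apply/tZ/rspan_in; rewrite /t mem_cat.
  by apply/orP; left; apply: map_f; rewrite mem_enum.
apply: tD => //; apply: (rspan_mono (X := fun z => z \in s')).
  by move=> z zs; rewrite /t mem_cat zs orbT.
apply: s'P; split.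
  apply: rsubmoduleB => //; apply: rsubmodule_sum => // i; apply: WZ.
  by have [] := hP i.
have -> : v - u = w - \sum_i iota (c i) *: h i.
  have -> : u = iota r *: y + \sum_i iota (c i) *: h i.
    rewrite rE rmorph_sum scaler_suml -big_split /=.
    by apply: eq_bigr => i _; rewrite scalerDr scalerA -rmorphM.
  by rewrite vE opprD addrACA subrr add0r.
apply: rsubmoduleB => //; apply: rsubmodule_sum => // i; apply: sZ.
by have [] := hP i.
Qed.

End OneModule.

(** A copy of [M] tagged by [f]: the R-module structure is declared on it, apart from the A-module
    structure of [M]. *)
Definition res (f : {rmorphism R -> A}) (M : lmodType A) : Type := M.

End ScalarSpan.

(** * Restriction of scalars along [iota] *)

Section Restriction.

Variables (R A : pzRingType) (iota : {rmorphism R -> A}) (M : lmodType A).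

HB.instance Definition _ := GRing.Zmodule.on (res iota M).

Lemma res_scalerA (a b : R) (v : M) :
  iota a *: (iota b *: v) = iota (a * b) *: v.
Proof. by rewrite scalerA rmorphM. Qed.

Lemma res_scale1r (v : M) : iota 1 *: v = v.
Proof. by rewrite rmorph1 scale1r. Qed.

Lemma res_scalerDr : right_distributive (fun (a : R) (v : M) => iota a *: v) +%R.
Proof. by move=> a u v; rewrite scalerDr. Qed.

Lemma res_scalerDl (v : M) : {morph (fun a : R => iota a *: v) : a b / a + b}.
Proof. by move=> a b; rewrite rmorphD scalerDl. Qed.

HB.instance Definition _ := GRing.Zmodule_isLmodule.Build R (res iota M)
  res_scalerA res_scale1r res_scalerDr res_scalerDl.

Variables (W : M -> Prop) (hW : rsubmodule iota W).

Lemma res_submodule : submodule (M := res iota M) W.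
Proof. by case: hW. Qed.

Definition resmod : lmodType R := submod res_submodule.

Lemma resmod_fingen : left_noetherian R -> rfingen iota W -> fin_generated resmod.
Proof.
move=> hnoeth /(rfingen_noetherian hnoeth hW)[s [sW Ws]].
have sW' (j : 'I_(size s)) : W (s`_j) by apply/sW/mem_nth.
exists (size s), (fun j => submod_elt res_submodule (sW' j)) => m.
have [c vE] := rspan_seq (Ws _ (submodP m)).
exists c; apply: val_inj; rewrite [LHS]vE.
rewrite [RHS](raddf_sum (val : {additive resmod -> res iota M})).
by [].
Qed.

End Restriction.

(** * Reordering words in a skew PBW extension *)

Section InvertibleScalars.

Variable R : pzRingType.
Implicit Types (a b : R).

Lemma invertible1 : invertible (1 : R).
Proof. by exists 1; rewrite mulr1. Qed.

Lemma invertibleM a b : invertible a -> invertible b -> invertible (a * b).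
Proof.
move=> [c [ca ac]] [d [db bd]]; exists (d * c); split.
  by rewrite mulrA -[d * c * a]mulrA ca mulr1.
by rewrite mulrA -[a * b * d]mulrA bd mulr1.
Qed.

End InvertibleScalars.

Section ScalarSpanInRing.

Variables (R A : pzRingType) (iota : {rmorphism R -> A}).
Implicit Types (X Y : A -> Prop).

Definition aspan X (a : A) : Prop := rspan iota (M := A^o) X a.

Lemma aspan0 X : aspan X 0.
Proof. exact: rspan0. Qed.

Lemma aspanD X a b : aspan X a -> aspan X b -> aspan X (a + b).
Proof. by have [_ + _] := rspan_submodule iota (X : A^o -> Prop); apply. Qed.

Lemma aspanZ X r a : aspan X a -> aspan X (iota r * a).
Proof. by have [_ _ +] := rspan_submodule iota (X : A^o -> Prop); apply. Qed.

Lemma aspanN X a : aspan X a -> aspan X (- a).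
Proof. exact: rsubmoduleN (rspan_submodule iota (X : A^o -> Prop)). Qed.

Lemma aspanB X a b : aspan X a -> aspan X b -> aspan X (a - b).
Proof. by move=> sa sb; apply: aspanD => //; apply: aspanN. Qed.

Lemma aspan_in X a : X a -> aspan X a.
Proof. exact: rspan_in. Qed.

Lemma aspan_sum X I (s : seq I) (F : I -> A) :
  (forall i, aspan X (F i)) -> aspan X (\sum_(i <- s) F i).
Proof. move=> XF; elim/big_ind: _ => //; [exact: aspan0 | exact: aspanD]. Qed.

Lemma aspan_ind X (W : A -> Prop) : W 0 ->
  (forall r y a, X y -> aspan X a -> W a -> W (iota r * y + a)) ->
  forall a, aspan X a -> W a.
Proof. by move=> W0 WS a; elim=> // r y b Xy sb; apply: WS. Qed.

Lemma aspan_sub X Y : (forall a, X a -> aspan Y a) ->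
  forall a, aspan X a -> aspan Y a.
Proof. exact: (@rspan_sub_seq _ _ iota A^o X Y). Qed.

Lemma aspan_map X Y (f : A -> A) : f 0 = 0 ->
  (forall a b, f (a + b) = f a + f b) ->
  (forall r a, X a -> aspan Y (f (iota r * a))) ->
  forall a, aspan X a -> aspan Y (f a).
Proof.
move=> f0 fD fX a; elim/aspan_ind=> [|r y b Xy _ IH]; first by rewrite f0; apply: aspan0.
by rewrite fD; apply: aspanD => //; apply: fX.
Qed.

End ScalarSpanInRing.

Section Words.

Variables (R A : pzRingType) (iota : {rmorphism R -> A}).
Variables (n : nat) (x : 'I_n -> A).
Local Notation mnm := 'X_{1..n}.

Definition mon (m : mnm) : A := \prod_(i < n) x i ^+ m i.

(** [Q] is arbitrary because two bounds on exponents occur: total degree when words are reordered,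
    and the monomial order for leading terms. *)
Definition mspan (Q : mnm -> Prop) : A -> Prop :=
  aspan iota (fun y => exists2 m, Q m & y = mon m).

Lemma mspan_mono (Q Q' : mnm -> Prop) a :
  (forall m, Q m -> Q' m) -> mspan Q a -> mspan Q' a.
Proof.
by move=> QQ; apply: aspan_sub => _ [m /QQ Qm ->]; apply: aspan_in; exists m.
Qed.

Lemma mspan_mon (Q : mnm -> Prop) m : Q m -> mspan Q (mon m).
Proof. by move=> Qm; apply: aspan_in; exists m. Qed.

Lemma mspan_normal Q a : mspan Q a -> exists (s : seq mnm) (c : mnm -> R),
  [/\ uniq s, forall m, m \in s -> Q m & a = \sum_(m <- s) iota (c m) * mon m].
Proof.
elim/aspan_ind=> [|r _ b [m Qm ->] _ [s [c [us Qs ->]]]].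
  by exists [::], (fun=> 0); rewrite big_nil.
(* Outside [s] the value of [c] is arbitrary, hence the test on [m]. *)
pose c' m' := if m' == m then (if m \in s then c m else 0) + r else c m'.
have c'E s' : m \notin s' ->
    \sum_(m' <- s') iota (c' m') * mon m' = \sum_(m' <- s') iota (c m') * mon m'.
  move=> ms'; apply: eq_big_seq => m' m's'; rewrite /c'.
  by case: eqP => // e; rewrite -e m's' in ms'.
have [ms|ms] := boolP (m \in s); last first.
  exists (m :: s), c'; split=> [|m'|]; first by rewrite /= ms.
    by rewrite inE => /orP[/eqP->//|/Qs].
  by rewrite big_cons c'E // /c' eqxx (negPf ms) add0r.
exists s, c'; split=> //.
rewrite !(perm_big _ (perm_to_rem ms)) !big_cons /= c'E.
  by rewrite /c' eqxx ms rmorphD mulrDl addrA [iota r * _ + _]addrC.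
by rewrite mem_rem_uniq // inE eqxx.
Qed.

Definition ffun_of_mnm (m : mnm) : {ffun 'I_n -> nat} := [ffun i => m i].
Definition mnm_of_ffun (f : {ffun 'I_n -> nat}) : mnm := [multinom f i | i < n].

Lemma ffun_of_mnmK : cancel ffun_of_mnm mnm_of_ffun.
Proof. by move=> m; apply/mnmP => i; rewrite mnmE ffunE. Qed.

Lemma pbw_monE f : pbw_mon x f = mon (mnm_of_ffun f).
Proof. by apply: eq_bigr => i _; rewrite mnmE. Qed.

Hypothesis hA : bijective_skew_pbw_extension iota x.

Lemma mspanT a : mspan (fun=> True) a.
Proof.
have [[_ [sp _] _ _] _ _] := hA; have [s [c ->]] := sp a.
by apply: aspan_sum => f; apply: aspanZ; rewrite pbw_monE; apply: mspan_mon.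
Qed.

(** The form in which independence of the monomials is used: a normal form of the combination has no
    term at [m], so [- r] at [m] completes it to a vanishing sum over distinct monomials. *)
Lemma mspan_indep (Q : mnm -> Prop) m r :
  ~ Q m -> mspan Q (iota r * mon m) -> r = 0.
Proof.
move=> Qm /mspan_normal[s [c [us Qs rE]]].
have [[_ [_ ind] _ _] _ _] := hA.
have ms : m \notin s by apply/negP => /Qs.
pose c' f := if f == ffun_of_mnm m then - r else c (mnm_of_ffun f).
have us' : uniq (map ffun_of_mnm (m :: s)).
  by rewrite map_inj_uniq ?cons_uniq ?ms //; apply: can_inj ffun_of_mnmK.
have c'm : c' (ffun_of_mnm m) = - r by rewrite /c' eqxx.
apply: oppr_inj; rewrite oppr0 -c'm; apply: ind us' _ _ (mem_head _ _).
rewrite big_map big_cons c'm.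
rewrite pbw_monE ffun_of_mnmK rmorphN mulNr rE addrC.
apply/eqP; rewrite subr_eq0; apply/eqP; apply: eq_big_seq => m' m's.
rewrite /c' (can_eq ffun_of_mnmK) pbw_monE ffun_of_mnmK.
by case: eqP => // e; rewrite -e m's in ms.
Qed.

Lemma mon0 : mon 0%MM = 1.
Proof. by rewrite /mon big1 // => i _; rewrite mnm0E. Qed.

Lemma mon1 i : mon U_(i)%MM = x i.
Proof.
rewrite /mon; pose F j := if j == i then x i else 1.
have FE j : x j ^+ U_(i)%MM j = F j.
  by rewrite mnm1E /F eq_sym; case: eqP => [->|].
rewrite (eq_bigr F) // /F -big_mkcond /= big_pred1_eq.
by [].
Qed.

(** Comparing coefficients of [x i] is how the bare commutation identity yields that sigma preserves
    0, 1 and products. *)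
Lemma iota_scalar_lead i a a' b b' :
  iota a * x i + iota b = iota a' * x i + iota b' -> a = a'.
Proof.
move=> e; apply/eqP; rewrite -subr_eq0; apply/eqP.
apply: (mspan_indep (Q := fun m => m = 0%MM) (m := U_(i)%MM)).
  by move/eqP; rewrite mnm1_eq0.
have -> : iota (a - a') * mon U_(i) = iota (b' - b) * mon 0%MM.
  rewrite mon1 mon0 mulr1 !rmorphB mulrBl.
  by apply/eqP; rewrite subr_eq [_ + _ * _]addrC addrA -e addrK.
exact/aspanZ/mspan_mon.
Qed.

Definition twist (i : 'I_n) (sigma : R -> R) : Prop :=
  bijective sigma /\ exists delta, pbw_sigma_delta iota x i sigma delta.

Lemma twist_ex : exists sigma : 'I_n -> R -> R, forall i, twist i (sigma i).
Proof.
suff /boolp.choice[s sP] : forall i, exists s, twist i s by exists s.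
move=> i; have [_ /(_ i)[s [d [sd bs]]] _] := hA.
by exists s; split=> //; exists d.
Qed.

Lemma twist0 i s : twist i s -> s 0 = 0.
Proof.
move=> [_ [d /(_ 0)]]; rewrite rmorph0 mulr0 => e.
by apply/esym/(@iota_scalar_lead i _ _ 0 (d 0)); rewrite -e rmorph0 mul0r addr0.
Qed.

Lemma twist1 i s : twist i s -> s 1 = 1.
Proof.
move=> [_ [d /(_ 1)]]; rewrite rmorph1 mulr1 => e.
by apply/esym/(@iota_scalar_lead i _ _ 0 (d 1)); rewrite -e rmorph0 rmorph1 mul1r addr0.
Qed.

Lemma twistM i s a b : twist i s -> s (a * b) = s a * s b.
Proof.
move=> [_ [d sd]].
apply: (@iota_scalar_lead i _ _ (d (a * b)) (s a * d b + d a * b)).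
rewrite -sd rmorphM mulrA sd mulrDl -mulrA sd mulrDr rmorphD !rmorphM.
by rewrite !mulrA !addrA.
Qed.

Lemma twist_invertible i s u : twist i s -> invertible u -> invertible (s u).
Proof.
move=> ts [v [vu uv]]; exists (s v).
by rewrite -!(twistM _ _ ts) vu uv (twist1 ts).
Qed.

Definition wprod (w : seq 'I_n) : A := \prod_(i <- w) x i.

Lemma wprod_cons i w : wprod (i :: w) = x i * wprod w.
Proof. by rewrite /wprod big_cons. Qed.

(** All words are allowed, not only ordered monomials: left multiplication by [x i] is then
    controlled before any reordering is known. *)
Definition wspan (d : nat) : A -> Prop :=
  aspan iota (fun y => exists2 w, (size w < d)%N & y = wprod w).

Lemma wspan_word d w : (size w < d)%N -> wspan d (wprod w).
Proof. by move=> wd; apply: aspan_in; exists w. Qed.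

Lemma wspan_mono d e a : (d <= e)%N -> wspan d a -> wspan e a.
Proof.
by move=> de; apply: aspan_sub => _ [w wd ->]; apply: wspan_word; apply: leq_trans de.
Qed.

Lemma wspan_mul_x d i a : wspan d a -> wspan d.+1 (x i * a).
Proof.
have [s /(_ i)[_ [dl sd]]] := twist_ex.
apply: aspan_map => [|b c|r _ [w wd ->]]; [exact: mulr0 | exact: mulrDr |].
rewrite mulrA sd mulrDl -mulrA -wprod_cons.
by apply: aspanD; apply/aspanZ/wspan_word => //; apply: ltnW.
Qed.

Definition weq (w v : seq 'I_n) : Prop :=
  exists2 u, invertible u & wspan (size w) (wprod w - iota u * wprod v).

Lemma weq_refl w : weq w w.
Proof.
by exists 1; [apply: invertible1 | rewrite rmorph1 mul1r subrr; apply: aspan0].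
Qed.

Lemma weq_sym w v : size w = size v -> weq w v -> weq v w.
Proof.
move=> wv [u [u' [u'u uu']]]; rewrite wv => uP.
exists u'; first by exists u.
have := aspanN (aspanZ u' uP).
by rewrite mulrBr mulrA -rmorphM u'u rmorph1 mul1r opprB.
Qed.

Lemma weq_trans w v z : size w = size v -> weq w v -> weq v z -> weq w z.
Proof.
move=> wv [a ia aP] [b ib bP]; exists (a * b); first exact: invertibleM.
have := aspanD aP (aspanZ a (eq_ind_r (fun d => wspan d _) bP wv)).
by rewrite mulrBr mulrA -rmorphM addrA subrK.
Qed.

(** Moving [x i] past the unit [u] replaces it by [s i u], again a unit, at the cost of a shorter
    word. *)
Lemma weq_cons i w v : size w = size v -> weq w v -> weq (i :: w) (i :: v).
Proof.
move=> wv [u iu uP]; have [s /(_ i) si] := twist_ex; have [_ [d sd]] := si.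
exists (s i u); first exact: twist_invertible si iu.
have vs : wspan (size w).+1 (wprod v) by apply: wspan_word; rewrite wv.
have := aspanD (wspan_mul_x i uP) (aspanZ (d u) vs).
by rewrite mulrBr [x i * (_ * _)]mulrA sd mulrDl -!mulrA -!wprod_cons opprD addrA subrK.
Qed.

(** Invertibility of the commutation coefficient is given only for [i < j]; the opposite order
    follows by symmetry of [weq]. *)
Lemma weq_swap i j w : weq (j :: i :: w) (i :: j :: w).
Proof.
wlog ij : i j / (i < j)%N => [th|].
  case: (ltngtP i j) => [/th//|/th ji|/val_inj ->]; last exact: weq_refl.
  exact: weq_sym.
have [_ _ /(_ i j ij)[c [[_ [r0 [r rE]]] ic]]] := hA.
exists c => //; rewrite !wprod_cons !mulrA -mulrBl rE mulrDl mulr_suml.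
apply: aspanD; first by apply/aspanZ/wspan_word => /=.
by apply: aspan_sum => k; rewrite -mulrA -wprod_cons; apply/aspanZ/wspan_word.
Qed.

Lemma weq_move i w1 w2 : weq (w1 ++ i :: w2) (i :: w1 ++ w2).
Proof.
elim: w1 => [|j w1 IH]; first exact: weq_refl.
apply: weq_trans (weq_swap i j _); first by rewrite /= !size_cat /= addnS.
by apply: weq_cons; rewrite // /= !size_cat /= addnS.
Qed.

Lemma weq_perm w v : perm_eq w v -> weq w v.
Proof.
elim: w v => [|i w IH] v pv.
  by move: pv; rewrite perm_sym => /perm_nilP ->; apply: weq_refl.
have iv : i \in v by rewrite -(perm_mem pv) mem_head.
have sz := perm_size pv; move: pv sz; case/splitPr: iv => v1 v2 pv sz.
have pw : perm_eq w (v1 ++ v2) by rewrite -(perm_cons i) (permPl pv) -(cat1s i v2) perm_catCA.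
apply: weq_trans (weq_cons i _ (IH _ pw)) _; rewrite ?(perm_size pw) //=.
  by rewrite (perm_size pw).
apply: weq_sym; last exact: weq_move.
by rewrite !size_cat /= !size_cat addnS.
Qed.

Definition word (m : mnm) : seq 'I_n := flatten [seq nseq (m i) i | i <- index_enum 'I_n].

Definition wmnm (w : seq 'I_n) : mnm := [multinom count_mem i w | i < n].

Lemma wprod_word m : wprod (word m) = mon m.
Proof.
rewrite /wprod /mon big_flatten big_map /=.
by apply: eq_bigr => i _; elim: (m i) => [|k IH]; rewrite ?big_nil // big_cons IH exprS.
Qed.

Lemma count_word m i : count_mem i (word m) = m i.
Proof.
rewrite count_flatten -map_comp sumnE big_map (bigD1 i) //= big1 => [|j ji].
  by rewrite count_nseq /= eqxx mul1n addn0.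
by rewrite count_nseq /= (negPf ji).
Qed.

Lemma perm_word w (m : mnm) : (forall i, count_mem i w = m i) -> perm_eq w (word m).
Proof. by move=> wm; apply/allP => i _ /=; rewrite wm count_word. Qed.

Lemma perm_wmnm w : perm_eq w (word (wmnm w)).
Proof. by apply: perm_word => i; rewrite mnmE. Qed.

Lemma size_word m : size (word m) = mdeg m.
Proof.
rewrite size_flatten /shape -map_comp sumnE big_map /= mdegE.
by apply: eq_bigr => i _; rewrite size_nseq.
Qed.

Definition deg_lt (d : nat) (m : mnm) : Prop := (mdeg m < d)%N.

(** Sorting a word leaves an error made of strictly shorter words, to which induction on the length
    applies. *)
Lemma wspan_mspan d a : wspan d a -> mspan (deg_lt d) a.
Proof.
elim: d a => [|d IH] a; first by apply: aspan_sub => y [].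
apply: aspan_sub => _ [w wd ->].
have pw := perm_wmnm w; have [u iu uP] := weq_perm pw.
rewrite -[wprod w](subrK (iota u * wprod (word (wmnm w)))); apply: aspanD.
  apply: (mspan_mono (Q := deg_lt d)) (IH _ (wspan_mono _ uP)) => // m.
  exact: ltnW.
apply: aspanZ; rewrite wprod_word; apply: mspan_mon.
by rewrite /deg_lt -size_word -(perm_size pw).
Qed.

Lemma mul_x_mon i m : exists2 u, invertible u &
  mspan (deg_lt (mdeg m).+1) (x i * mon m - iota u * mon (m + U_(i))%MM).
Proof.
have pw : perm_eq (i :: word m) (word (m + U_(i))%MM).
  apply: perm_word => j; rewrite /= count_word mnmDE mnm1E addnC.
  by rewrite eq_sym.
have [u iu uP] := weq_perm pw; exists u => //.
by move: (wspan_mspan uP); rewrite wprod_cons !wprod_word /= size_word.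
Qed.

(** [t] is the composite of the sigma of the letters of [w]. *)
Lemma wprod_mul_scalar w : exists2 t : R -> R, bijective t /\ t 0 = 0 &
  forall r, wspan (size w) (wprod w * iota r - iota (t r) * wprod w).
Proof.
elim: w => [|i w [t [bt t0] tP]].
  exists id; first by split=> //; exists id.
  by move=> r; rewrite /wprod big_nil mulr1 mul1r subrr; apply: aspan0.
have [s /(_ i) si] := twist_ex; have [bs [d sd]] := si.
exists (s i \o t); first by split; [apply: bij_comp | rewrite /= t0 (twist0 si)].
move=> r; have := aspanD (wspan_mul_x i (tP r))
  (aspanZ (d (t r)) (wspan_word (leqnn (size w).+1))).
rewrite mulrBr !mulrA sd mulrDl -!mulrA -!wprod_cons opprD addrA subrK.
by rewrite mulrA -wprod_cons.
Qed.

Lemma mon_mul_scalar m : exists2 t : R -> R, bijective t /\ t 0 = 0 &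
  forall r, mspan (deg_lt (mdeg m)) (mon m * iota r - iota (t r) * mon m).
Proof.
have [t ht tP] := wprod_mul_scalar (word m); exists t => // r.
by move: (wspan_mspan (tP r)); rewrite wprod_word size_word.
Qed.

End Words.

(** * Leading terms *)

Section LeadingTerms.

Variables (R A : pzRingType) (iota : {rmorphism R -> A}).
Variables (n : nat) (x : 'I_n -> A).
Hypothesis hA : bijective_skew_pbw_extension iota x.
Local Notation mnm := 'X_{1..n}.
Local Notation mspan := (mspan iota x).
Local Notation mon := (mon x).

(** The second condition absorbs both errors: the derivation term, a multiple of [mon m] itself, and
    the reordering terms, of degree at most that of [m]. *)
Lemma mspan_mul_x (Q Q' : mnm -> Prop) i a :
    (forall m, Q m -> Q' (m + U_(i))%MM) ->
    (forall m m', Q m -> (mdeg m' <= mdeg m)%N -> Q' m') ->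
  mspan Q a -> mspan Q' (x i * a).
Proof.
move=> QU Qdeg; have [s /(_ i)[_ [dl sd]]] := twist_ex hA.
apply: aspan_map => [|b c|r _ [m Qm ->]]; [exact: mulr0 | exact: mulrDr |].
rewrite mulrA sd mulrDl -mulrA; apply: aspanD; last first.
  by apply/aspanZ/mspan_mon/(Qdeg m).
apply: aspanZ; have [u _ uP] := mul_x_mon hA i m.
rewrite -[_ * _](subrK (iota u * mon (m + U_(i))%MM)); apply: aspanD.
  by apply: mspan_mono uP => m'; rewrite /deg_lt ltnS; apply: Qdeg.
exact/aspanZ/mspan_mon/QU.
Qed.

Lemma mspan_mul_scalar (Q : mnm -> Prop) r a :
    (forall m m', Q m -> (mdeg m' < mdeg m)%N -> Q m') ->
  mspan Q a -> mspan Q (a * iota r).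
Proof.
move=> Qdeg; apply: (aspan_map (f := fun a => a * iota r)) => [|b c|s _ [m Qm ->]].
- exact: mul0r.
- exact: mulrDl.
rewrite -mulrA; apply: aspanZ; have [t _ tP] := mon_mul_scalar hA m.
rewrite -[_ * _](subrK (iota (t r) * mon m)); apply: aspanD.
  by apply: mspan_mono (tP r) => m'; apply: Qdeg.
exact/aspanZ/mspan_mon.
Qed.

Lemma mspan_lead (Q Q' : mnm -> Prop) m0 a :
    (forall m, Q m -> m = m0 \/ Q' m) -> mspan Q a ->
  exists r, mspan Q' (a - iota r * mon m0).
Proof.
move=> QQ'; elim/aspan_ind=> [|r _ b [m /QQ' Qm ->] _ [c cP]].
  by exists 0; rewrite rmorph0 mul0r subrr; apply: aspan0.
case: Qm => [->|Qm].
  by exists (r + c); rewrite rmorphD mulrDl opprD addrACA subrr add0r.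
by exists c; rewrite -addrA; apply: aspanD => //; apply/aspanZ/mspan_mon.
Qed.

(** The degree filtration of a free module of rank one whose generator is placed in degree [b]. *)
Definition sp_le (b a : mnm) : A -> Prop := mspan (fun m => ((m + b)%MM <= a)%O).
Definition sp_lt (b a : mnm) : A -> Prop := mspan (fun m => ((m + b)%MM < a)%O).

Lemma mnm_addAC (a b c : mnm) : (a + b + c = a + c + b)%MM.
Proof. by apply/mnmP => i; rewrite !mnmDE addnAC. Qed.

Lemma ltm_addU (m m' a b : mnm) i : ((m + b)%MM <= a)%O ->
  (mdeg m' <= mdeg m)%N -> ((m' + b)%MM < (a + U_(i))%MM)%O.
Proof.
move=> /lemc_mdeg; rewrite mdegD => mb mm'; apply: lt_mdeg_ltmc.
rewrite !mdegD mdeg1 addn1 ltnS; apply: leq_trans mb.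
by rewrite leq_add2r.
Qed.

Lemma sp_le_mul_x b a i c : sp_le b a c -> sp_le b (a + U_(i))%MM (x i * c).
Proof.
apply: mspan_mul_x => [m mb|m m' mb mm'].
  by rewrite mnm_addAC lemc_add2l.
exact/ltW/(ltm_addU i mb).
Qed.

Lemma sp_lt_mul_x b a i c : sp_lt b a c -> sp_lt b (a + U_(i))%MM (x i * c).
Proof.
apply: mspan_mul_x => [m mb|m m' /ltW mb mm'].
  by rewrite mnm_addAC ltmc_add2l.
exact: (ltm_addU i mb).
Qed.

(** The graded piece of degree [a] is zero or generated by [mon m0] with m0 + b = a. On its
    coefficient [x i] acts by r |-> s(r) u with [s] bijective and [u] a unit. *)
Lemma sp_lt_inj b a i c :
  sp_le b a c -> sp_lt b (a + U_(i))%MM (x i * c) -> sp_lt b a c.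
Proof.
move=> cP xc; case: (pselect (exists m0, (m0 + b)%MM = a)) => [[m0 m0b]|none]; last first.
  apply: mspan_mono cP => m; rewrite le_eqVlt => /orP[/eqP e|//].
  by case: none; exists m.
have [r rP] : exists r, sp_lt b a (c - iota r * mon m0).
  apply: mspan_lead cP => m; rewrite le_eqVlt -m0b => /orP[/eqP|->]; last by right.
  by move/addIm; left.
suff r0 : r = 0 by move: rP; rewrite r0 rmorph0 mul0r subr0.
have [s /(_ i) si] := twist_ex hA; have [bs [d sd]] := si.
have [u [v [vu uv]] uP] := mul_x_mon hA i m0.
suff : s i r * u = 0.
  move=> e; apply: (bij_inj bs); rewrite (twist0 hA si).
  by rewrite -[s i r]mulr1 -uv mulrA e mul0r.
apply: (mspan_indep hA (Q := fun m => ((m + b)%MM < (a + U_(i))%MM)%O)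
  (m := (m0 + U_(i))%MM)).
  by rewrite mnm_addAC m0b ltxx.
have m0a : ((m0 + b)%MM <= a)%O by rewrite m0b.
have low1 : sp_lt b (a + U_(i))%MM (x i * mon m0 - iota u * mon (m0 + U_(i))%MM).
  by apply: mspan_mono uP => m; rewrite /deg_lt ltnS; apply: ltm_addU.
have low2 : sp_lt b (a + U_(i))%MM (mon m0).
  exact/mspan_mon/(ltm_addU i m0a).
have low3 := aspanB xc (sp_lt_mul_x i rP).
rewrite mulrBr opprB addrCA subrr addr0 mulrA sd mulrDl in low3.
have := aspanB (aspanB low3 (aspanZ (d r) low2)) (aspanZ (s i r) low1).
by rewrite addrK -mulrA mulrBr opprB addrC subrK mulrA -rmorphM.
Qed.

Lemma sp_lt_surj (b a : mnm) i c : (b i <= a i)%N -> sp_le b (a + U_(i))%MM c ->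
  exists c', sp_le b a c' /\ sp_lt b (a + U_(i))%MM (c - x i * c').
Proof.
move=> bai cP; case: (pselect (exists m0, (m0 + b)%MM = a)) => [[m0 m0b]|none]; last first.
  exists 0; split; first exact: aspan0.
  rewrite mulr0 subr0; apply: mspan_mono cP => m; rewrite le_eqVlt => /orP[/eqP e|//].
  (* If m + b = a + U_(i), then [b i <= a i] makes [b] divide [a], so the piece of degree [a] is not
     zero either. *)
  case: none; exists (a - b)%MM; apply/mnmP => j; rewrite mnmDE mnmBE subnK //.
  have /mnmP/(_ j) := e; rewrite !mnmDE mnm1E; case: eqP => [<- //|_].
  by rewrite addn0 => <-; apply: leq_addl.
have m0a : ((m0 + b)%MM <= a)%O by rewrite m0b.
have [r rP] : exists r, sp_lt b (a + U_(i))%MM (c - iota r * mon (m0 + U_(i))%MM).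
  apply: mspan_lead cP => m; rewrite le_eqVlt => /orP[/eqP e|]; last by right.
  by left; apply: (@addIm _ b); rewrite e -m0b mnm_addAC.
have [s /(_ i) si] := twist_ex hA; have [[t tK sK] [d sd]] := si.
have [u [v [vu uv]] uP] := mul_x_mon hA i m0.
(* The coefficient solves s(z) u = r, with [t] inverse to [s i] and [v] inverse to [u]. *)
exists (iota (t (r * v)) * mon m0); split; first exact/aspanZ/mspan_mon.
have low1 : sp_lt b (a + U_(i))%MM (x i * mon m0 - iota u * mon (m0 + U_(i))%MM).
  by apply: mspan_mono uP => m; rewrite /deg_lt ltnS; apply: ltm_addU.
have low2 : sp_lt b (a + U_(i))%MM (mon m0).
  exact/mspan_mon/(ltm_addU i m0a).
have := aspanB (aspanB rP (aspanZ (d (t (r * v))) low2)) (aspanZ (r * v) low1).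
congr sp_lt; rewrite mulrA sd sK mulrDl -mulrA mulrBr [iota _ * (iota u * _)]mulrA.
rewrite -rmorphM -[r * v * u]mulrA vu mulr1.
set p := iota r * _; set q := iota (d _) * _; set w := iota (r * v) * _.
by rewrite opprB [c - p - q]addrAC addrA subrK opprD addrA addrAC.
Qed.

Lemma sp_le_mono b a a' c : (a <= a')%O -> sp_le b a c -> sp_le b a' c.
Proof. by move=> aa'; apply: mspan_mono => m mb; apply: le_trans aa'. Qed.

Lemma sp_lt_le b a c : sp_lt b a c -> sp_le b a c.
Proof. by apply: mspan_mono => m /ltW. Qed.

Lemma sp_le_lt b a a' c : (a < a')%O -> sp_le b a c -> sp_lt b a' c.
Proof. by move=> aa'; apply: mspan_mono => m mb; apply: le_lt_trans aa'. Qed.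

Lemma sp_le_ex b c : exists a, sp_le b a c.
Proof.
have := mspanT hA c; elim/aspan_ind=> [|r _ c' [m _ ->] _ [a aP]].
  by exists 0%MM; apply: aspan0.
exists (Order.max a (m + b)%MM); apply: aspanD.
  by apply/aspanZ/mspan_mon; rewrite le_max lexx orbT.
by apply: sp_le_mono aP; rewrite le_max lexx.
Qed.

Lemma sp_lt_low b a c : (0%MM < a)%O -> sp_lt b a c ->
  exists2 a', (a' < a)%O & sp_le b a' c.
Proof.
move=> a0; elim/aspan_ind=> [|r _ c' [m mb ->] _ [a' a'a aP]].
  by exists 0%MM => //; apply: aspan0.
exists (Order.max a' (m + b)%MM); first by rewrite gt_max a'a.
apply: aspanD; first by apply/aspanZ/mspan_mon; rewrite le_max lexx orbT.
by apply: sp_le_mono aP; rewrite le_max lexx.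
Qed.

Lemma sp_lt0 b c : sp_lt b 0%MM c -> c = 0.
Proof.
elim/aspan_ind=> // r _ c' [m mb ->]; move: mb.
by rewrite ltNge (le0x (m + b)%MM).
Qed.

End LeadingTerms.

(** * Filtered modules *)

Section Filtered.

Variables (R A : pzRingType) (iota : {rmorphism R -> A}).
Variables (n : nat) (x : 'I_n -> A).
Local Notation mnm := 'X_{1..n}.
Local Notation mon := (mon x).
Local Notation sp_le := (sp_le iota x).
Local Notation sp_lt := (sp_lt iota x).
Implicit Types (a b : mnm).

(* [F a] and [G a] are the elements of filtration degree [<= a] and [< a];
   [fil_inj] and [fil_surj] express the bijectivity of multiplication by [x i]
   between the quotients [F a / G a], which are never formed. *)
Record filtered (N : nat) (M : lmodType A) (F G : mnm -> M -> Prop) : Prop :=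
  Filtered {
    fil_sub : forall a, rsubmodule iota (F a);
    gil_sub : forall a, rsubmodule iota (G a);
    gil_le : forall a v, G a v -> F a v;
    fil_lt : forall a b v, (a < b)%O -> F a v -> G b v;
    fil_exh : forall v, exists a, F a v;
    gil_low : forall a v, G a v -> v = 0 \/ exists2 b, (b < a)%O & F b v;
    fil_x : forall a i v, F a v -> F (a + U_(i))%MM (x i *: v);
    gil_x : forall a i v, G a v -> G (a + U_(i))%MM (x i *: v);
    fil_inj : forall a i v, (N <= a i)%N -> F a v ->
      G (a + U_(i))%MM (x i *: v) -> G a v;
    fil_surj : forall a i v, (N <= a i)%N -> F (a + U_(i))%MM v ->
      exists2 u, F a u & G (a + U_(i))%MM (v - x i *: u);
    fil_fg : forall a, rfingen iota (F a)
  }.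

Lemma fil_mono N (M : lmodType A) (F G : mnm -> M -> Prop) a b v :
  filtered N F G -> (a <= b)%O -> F a v -> F b v.
Proof.
move=> hF; rewrite le_eqVlt => /orP[/eqP->//|ab Fv].
exact/(gil_le hF)/(fil_lt hF ab).
Qed.

Lemma fil_mon N (M : lmodType A) (F G : mnm -> M -> Prop) b v m :
  filtered N F G -> F b v -> F (m + b)%MM (mon m *: v).
Proof.
(* Both the monomial and its exponent are expressed through one word, so that the induction can run
   over words. *)
move=> hF Fv; rewrite -(wprod_word x m).
have -> : m = wmnm (word m) by apply/mnmP => i; rewrite mnmE count_word.
have -> : word (wmnm (word m)) = word m.
  by congr word; apply/mnmP => i; rewrite mnmE count_word.
elim: (word m) => [|i w IH].
  have -> : (wmnm [::] + b)%MM = b by apply/mnmP => j; rewrite mnmDE mnmE.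
  by rewrite /wprod big_nil scale1r.
rewrite wprod_cons -scalerA.
have -> : (wmnm (i :: w) + b = (wmnm w + b) + U_(i))%MM.
  by apply/mnmP => j; rewrite !(mnmDE, mnmE) /= -addnA addnC.
exact: (fil_x hF).
Qed.

Lemma fil_act N (M : lmodType A) (F G : mnm -> M -> Prop) b v a c :
  filtered N F G -> F b v -> sp_le b a c -> F a (c *: v).
Proof.
move=> hF Fv; have [F0 FD FZ] := fil_sub hF a.
elim/aspan_ind=> [|r _ c' [m mb ->] _ IH]; first by rewrite scale0r.
rewrite scalerDl -scalerA; apply/FD/IH/FZ.
exact: (fil_mono hF mb (fil_mon m hF Fv)).
Qed.

Lemma fin_bound m (f : 'I_m -> mnm) : exists2 a, (forall j, (f j <= a)%O) &
  forall b, (0%MM < b)%O -> (forall j, (f j < b)%O) -> (a < b)%O.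
Proof.
elim: m f => [|m IHm] f; first by exists 0%MM => // -[].
have [a fa ab] := IHm (fun j => f (lift ord0 j)).
exists (Order.max (f ord0) a) => [j|b b0 fb]; last first.
  by rewrite gt_max fb ab.
by rewrite le_max; case: (unliftP ord0 j) => [k ->|->]; rewrite ?lexx ?fa ?orbT.
Qed.

Hypothesis hA : bijective_skew_pbw_extension iota x.

(** * Free modules filtered by shifted generators *)

Section Free.

Variables (m : nat) (shift : 'I_m -> mnm).

Definition free_le (a : mnm) (v : 'rV[A]_m) : Prop :=
  forall j, sp_le (shift j) a (v 0 j).
Definition free_lt (a : mnm) (v : 'rV[A]_m) : Prop :=
  forall j, sp_lt (shift j) a (v 0 j).

Lemma mspan_rV_submodule (Q : 'I_m -> mnm -> Prop) :
  rsubmodule iota (fun v : 'rV[A]_m => forall j, mspan iota x (Q j) (v 0 j)).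
Proof.
split=> [j|u v hu hv j|r v hv j]; rewrite mxE.
- exact: aspan0.
- exact: aspanD (hu j) (hv j).
- exact: aspanZ (hv j).
Qed.

(** The order refines total degree, so only the finitely many monomials of degree at most [mdeg a]
    occur. *)
Lemma free_fg a : rfingen iota (free_le a).
Proof.
pose d := (mdeg a).+1.
pose s := [seq mon (bmnm p.1) *: delta_mx 0 p.2 |
           p <- enum [the finType of ('X_{1..n < d} * 'I_m)%type]] : seq 'rV[A]_m.
exists s => v Fv; rewrite (row_sum_delta v).
apply: rsubmodule_sum; first exact: rspan_submodule.
move=> j; elim/aspan_ind: (Fv j) => [|r _ c [p pb ->] _ IH].
  by rewrite scale0r; apply: rspan0.
rewrite scalerDl -scalerA; apply: rspan_step => //.
have pd : (mdeg p < d)%N.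
  rewrite ltnS; apply: leq_trans (lemc_mdeg pb).
  by rewrite mdegD leq_addr.
by apply/mapP; exists (BMultinom pd, j); rewrite ?mem_enum.
Qed.

Lemma free_filtered N : (forall j i, (shift j i <= N)%N) ->
  filtered N free_le free_lt.
Proof.
move=> shN; split.
- by move=> a; apply: mspan_rV_submodule.
- by move=> a; apply: mspan_rV_submodule.
- by move=> a v Gv j; apply: sp_lt_le.
- by move=> a b v ab Fv j; apply: sp_le_lt (Fv j).
- move=> v; have /boolp.choice[f fP] j := sp_le_ex hA (shift j) (v 0 j).
  have [a fa _] := fin_bound f; exists a => j.
  exact: sp_le_mono (fa j) (fP j).
- move=> a v Gv; have [a0|] := boolP (0%MM < a)%O.
    right; have /boolp.choice[f fP] j : exists b, (b < a)%O /\ sp_le (shift j) b (v 0 j).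
      by have [b] := sp_lt_low a0 (Gv j); exists b.
    have [b fb ba] := fin_bound f.
    exists b => [|j]; first by apply: ba => // j; have [] := fP j.
    by have [_] := fP j; apply: sp_le_mono.
  rewrite lt0x negbK => /eqP a0; left; apply/rowP => j; rewrite mxE.
  by move: (Gv j); rewrite a0; apply: sp_lt0.
- by move=> a i v Fv j; rewrite mxE; apply: sp_le_mul_x.
- by move=> a i v Gv j; rewrite mxE; apply: sp_lt_mul_x.
- move=> a i v Na Fv Gv j; apply: (sp_lt_inj hA (Fv j) (i := i)).
  by have := Gv j; rewrite mxE.
- move=> a i v Na Fv.
  have /boolp.choice[f fP] j := sp_lt_surj hA (leq_trans (shN j i) Na) (Fv j).
  exists (\row_j f j) => j; rewrite !mxE; first by have [] := fP j.
  by have [] := fP j.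
- exact: free_fg.
Qed.

End Free.

Lemma rfingen_image (M M' : lmodType A) (f : {linear M -> M'})
    (W : M -> Prop) (W' : M' -> Prop) :
  (forall v, W' v -> exists2 u, W u & f u = v) -> rfingen iota W -> rfingen iota W'.
Proof.
move=> WW' [s sP]; exists (map f s) => _ /WW'[u /sP su <-].
elim: su => [|r y w ys _ IH]; first by rewrite linear0; apply: rspan0.
by rewrite linearP; apply: rspan_step => //; apply: map_f.
Qed.

Lemma prod_filtered N (M M' : lmodType A) (F G : mnm -> M -> Prop)
    (F' G' : mnm -> M' -> Prop) :
  filtered N F G -> filtered N F' G' ->
  filtered N (fun a (v : M * M') => F a v.1 /\ F' a v.2)
             (fun a (v : M * M') => G a v.1 /\ G' a v.2).
Proof.
move=> hF hF'.
have prod_sub (W : M -> Prop) (W' : M' -> Prop) :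
    rsubmodule iota W -> rsubmodule iota W' ->
    rsubmodule iota (fun v : M * M' => W v.1 /\ W' v.2).
  move=> [W0 WD WZ] [W0' WD' WZ']; split=> // [u v [] ? ? [] ? ?|r v [] ? ?].
    by split; [apply: WD | apply: WD'].
  by split; [apply: WZ | apply: WZ'].
split.
- by move=> a; apply: prod_sub; [apply: fil_sub hF _ | apply: fil_sub hF' _].
- by move=> a; apply: prod_sub; [apply: gil_sub hF _ | apply: gil_sub hF' _].
- by move=> a v [] /(gil_le hF) ? /(gil_le hF') ?.
- by move=> a b v ab [] /(fil_lt hF ab) ? /(fil_lt hF' ab) ?.
- move=> v; have [a Fa] := fil_exh hF v.1; have [b Fb] := fil_exh hF' v.2.
  exists (Order.max a b).
  split; [apply: fil_mono hF _ Fa | apply: fil_mono hF' _ Fb];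
  by rewrite le_max lexx ?orbT.
- move=> a [v w] /= [/(gil_low hF) Gv /(gil_low hF') Gw].
  have F0 b : F b 0 by have [] := fil_sub hF b.
  have F0' b : F' b 0 by have [] := fil_sub hF' b.
  case: Gv Gw => [->|[b ba Fb]] [->|[c ca Fc]]; first by left.
  + by right; exists c.
  + by right; exists b.
  + right; exists (Order.max b c); first by rewrite gt_max ba ca.
    split; [apply: fil_mono hF _ Fb | apply: fil_mono hF' _ Fc];
    by rewrite le_max lexx ?orbT.
- by move=> a i v [] /(fil_x hF i) ? /(fil_x hF' i) ?.
- by move=> a i v [] /(gil_x hF i) ? /(gil_x hF' i) ?.
- by move=> a i v Na [] /(fil_inj hF Na) Fv /(fil_inj hF' Na) Fv' [/Fv ? /Fv' ?].
- move=> a i v Na [] /(fil_surj hF Na)[u Fu Gu] /(fil_surj hF' Na)[u' Fu' Gu'].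
  by exists (u, u').
- move=> a; have [s sP] := fil_fg hF a; have [s' sP'] := fil_fg hF' a.
  exists ([seq (v, 0) | v <- s] ++ [seq (0, v) | v <- s']) => -[v v'] /= [/sP sv /sP' sv'].
  have -> : (v, v') = (v, 0) + (0, v').
    by apply/pair_equal_spec; rewrite addr0 add0r.
  have [_ tD _] := rspan_submodule iota
    (fun y => y \in [seq (v, 0 : M') | v <- s] ++ [seq (0 : M, v) | v <- s']).
  apply: tD.
    elim: sv => [|r y w ys _ IH]; first exact: rspan0.
    have -> : (iota r *: y + w, 0) = iota r *: (y, 0 : M') + (w, 0).
      by apply/pair_equal_spec; rewrite /= scaler0 addr0.
    by apply: rspan_step => //; rewrite mem_cat map_f.
  elim: sv' => [|r y w ys _ IH]; first exact: rspan0.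
  have -> : (0, iota r *: y + w) = iota r *: (0 : M, y) + (0, w).
    by apply/pair_equal_spec; rewrite /= scaler0 addr0.
  by apply: rspan_step => //; rewrite mem_cat map_f ?orbT.
Qed.

Hypothesis hnoeth : left_noetherian R.

(** Strictness of [f] is the last hypothesis. Finite generation of the pieces of the kernel comes
    from [R] being left Noetherian; the graded surjectivity of [x i] on the kernel uses its
    injectivity on [M]. *)
Lemma ker_filtered N (E M : lmodType A) (f : {linear E -> M})
    (FE GE : mnm -> E -> Prop) (F G : mnm -> M -> Prop) :
    filtered N FE GE -> filtered N F G ->
    (forall a v, FE a v -> F a (f v)) ->
    (forall a u, F a u -> exists2 v, FE a v & f v = u) ->
  filtered N (fun a (k : kermod f) => FE a (val k))
             (fun a (k : kermod f) => GE a (val k)).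
Proof.
move=> hE hF fF Ff.
have fG a v : GE a v -> G a (f v).
  case/(gil_low hE) => [->|[b ba /fF]]; last exact: (fil_lt hF ba).
  by rewrite linear0; have [] := gil_sub hF a.
have Gf a u : G a u -> exists2 v, GE a v & f v = u.
  case/(gil_low hF) => [->|[b ba /Ff[v Fv <-]]]; last first.
    by exists v => //; apply: (fil_lt hE ba).
  by exists 0; rewrite ?linear0 //; have [] := gil_sub hE a.
have ker_sub (W : E -> Prop) : rsubmodule iota W ->
    rsubmodule iota (fun k : kermod f => W (val k)).
  move=> [W0 WD WZ]; split=> // [u v hu hv|r v hv]; [exact: WD | exact: WZ].
split.
- by move=> a; apply/ker_sub/(fil_sub hE).
- by move=> a; apply/ker_sub/(gil_sub hE).
- by move=> a v; apply: (gil_le hE).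
- by move=> a b v; apply: (fil_lt hE).
- by move=> v; apply: (fil_exh hE).
- move=> a v /(gil_low hE)[v0|[b ba Fb]]; last by right; exists b.
  by left; apply: val_inj.
- by move=> a i v; apply: (fil_x hE).
- by move=> a i v; apply: (gil_x hE).
- by move=> a i v; apply: (fil_inj hE).
(* A preimage [u] in [E] need not lie in the kernel, but [x i *: f u] has lower degree, hence so
   does [f u]. Subtracting a lift [w] of lower degree puts [u - w] in the kernel. *)
- move=> a i v Na Fv; have [u Fu Gu] := fil_surj hE Na Fv.
  have Gfu : G a (f u).
    apply: (fil_inj hF Na (fF _ _ Fu)); have := fG _ _ Gu.
    rewrite linearB linearZ /= (submodP v) sub0r => /rsubmoduleN.
    by rewrite opprK; apply; apply: gil_sub hF _.
  have [w Gw fw] := Gf _ _ Gfu.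
  have kw : f (u - w) = 0 by rewrite linearB fw subrr.
  exists (submod_elt (ker_submodule f) kw) => /=.
    by apply: rsubmoduleB (fil_sub hE a) Fu (gil_le hE Gw).
  have -> : sval v - x i *: (u - w) = (sval v - x i *: u) + x i *: w.
    by rewrite scalerBr opprB addrA addrAC.
  by have [_ GD _] := gil_sub hE (a + U_(i))%MM; apply: GD => //; apply: (gil_x hE).
- move=> a; pose W v := FE a v /\ f v = 0.
  have [E0 ED EZ] := fil_sub hE a.
  have hW : rsubmodule iota W.
    split=> [|u v [Fu fu] [Fv fv]|r v [Fv fv]]; first by rewrite /W linear0.
      by split; [apply: ED | rewrite linearD fu fv addr0].
    by split; [apply: EZ | rewrite linearZ /= fv scaler0].
  have [s' s'P] := fil_fg hE a.
  have [s [sW sP]] : exists s : seq E, (forall y, y \in s -> W y) /\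
      (forall v, W v -> rspan iota (fun y => y \in s) v).
    apply: (rfingen_noetherian hnoeth hW).
    by exists s' => v [] /s'P.
  exists (pmap insub s) => k Fk; have {Fk} : W (val k) by split=> //; apply: submodP k.
  move/sP; move: (erefl (val k)); move: {1 3}(val k) => v + sv.
  elim: sv k => [|r y w ys _ IH] k ke.
    have -> : k = 0 by apply: val_inj.
    exact: rspan0.
  have [Wy fy] := sW _ ys; pose y' := submod_elt (ker_submodule f) fy.
  have -> : k = iota r *: y' + (k - iota r *: y') by rewrite addrC subrK.
  apply: rspan_step; last by apply: IH => /=; rewrite -ke addrC addKr.
  by rewrite mem_pmap_sub.
Qed.

End Filtered.

(** * Existence of tame filtrations *)

Section Stabilisation.

Variable n : nat.
Local Notation mnm := 'X_{1..n}.
Implicit Types (a b : mnm).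

Lemma mnm_subUK a i : (0 < a i)%N -> (a - U_(i) + U_(i))%MM = a.
Proof.
move=> ai; apply/mnmP => j; rewrite mnmDE mnmBE mnm1E.
by case: eqP => [<-|_]; rewrite ?subnK // subn0 addn0.
Qed.

Lemma mnm_posP a : a = 0%MM \/ exists i, (0 < a i)%N.
Proof.
have [/existsP[i ai]|] := boolP [exists i, (0 < a i)%N]; first by right; exists i.
rewrite negb_exists => /forallP a0; left; apply/mnmP => i.
by apply/eqP; rewrite mnm0E -leqn0 leqNgt.
Qed.

Lemma mdeg_subU a i : (0 < a i)%N -> (mdeg (a - U_(i)) < mdeg a)%N.
Proof. by move=> ai; rewrite -{2}(mnm_subUK ai) mdegD mdeg1 addn1. Qed.

Variables (T : Type) (C : (T -> Prop) -> Prop).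

(** The ascending chain condition in abstract form; [C] will be [submodule] on row vectors over
    [R]. *)
Hypothesis chain : forall W : nat -> T -> Prop, (forall k, C (W k)) ->
  (forall k t, W k t -> W k.+1 t) ->
  C (fun t => exists k, W k t) /\ exists K, forall k t, W k t -> W K t.

Definition mnm_mono (f : mnm -> T -> Prop) : Prop :=
  forall a i t, f a t -> f (a + U_(i))%MM t.

Definition mnm_stable (N : nat) (f : mnm -> T -> Prop) : Prop :=
  forall a i t, (N <= a i)%N -> f (a + U_(i))%MM t -> f a t.

Lemma mnm_mono_le f a b t :
  mnm_mono f -> (forall i, a i <= b i)%N -> f a t -> f b t.
Proof.
move=> fU ab fa; have -> : b = (a + (b - a))%MM.
  by apply/mnmP => i; rewrite mnmDE mnmBE subnKC.
move: (b - a)%MM => c; elim/ltn_ind: (mdeg c) {-2}c (erefl (mdeg c)) => d IH {}c cd.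
case: (mnm_posP c) => [->|[i ci]].
  by rewrite addm0.
have -> : (a + c = a + (c - U_(i)) + U_(i))%MM.
  by rewrite -{1}(mnm_subUK ci); apply/mnmP => j; rewrite !mnmDE addnA.
by apply: fU; apply: IH (erefl _); rewrite -cd mdeg_subU.
Qed.

Definition clamp N a : mnm := [multinom minn N (a i) | i < n].

Lemma stable_clamp N f a t : mnm_stable N f -> f a t -> f (clamp N a) t.
Proof.
move=> fN; elim/ltn_ind: (mdeg a) {-2}a (erefl (mdeg a)) => d IH {}a ad fa.
have [/existsP[i ai]|] := boolP [exists i, (N < a i)%N]; last first.
  rewrite negb_exists => /forallP aN; suff -> : clamp N a = a by [].
  by apply/mnmP => i; rewrite mnmE; apply/minn_idPr; rewrite leqNgt.
have ai0 : (0 < a i)%N by apply: leq_ltn_trans ai.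
have Nai : (N <= (a - U_(i))%MM i)%N by rewrite mnmBE mnm1E eqxx subn1 -ltnS prednK.
have -> : clamp N a = clamp N (a - U_(i))%MM.
  apply/mnmP => j; rewrite !mnmE; case: eqP => [<-|_]; last by rewrite subn0.
  have := Nai; rewrite mnmBE mnm1E eqxx => Na'.
  by rewrite (minn_idPl (ltnW ai)) (minn_idPl Na').
apply: (IH (mdeg (a - U_(i)))) => //; first by rewrite -ad mdeg_subU.
by apply: fN Nai _; rewrite mnm_subUK.
Qed.

Definition setm (i : 'I_n) (t : nat) a : mnm :=
  [multinom if j == i then t else a j | j < n].

Lemma setm_id i a : setm i (a i) a = a.
Proof. by apply/mnmP => j; rewrite mnmE; case: eqP => [->|]. Qed.

Lemma setmS i t a : setm i t.+1 a = (setm i t a + U_(i))%MM.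
Proof.
apply/mnmP => j; rewrite mnmDE !mnmE [i == j]eq_sym.
by case: (j == i); rewrite ?addn1 ?addn0.
Qed.

Lemma setm_addU i t a : setm i t (a + U_(i))%MM = setm i t a.
Proof.
apply/mnmP => j; rewrite !mnmE; case: eqP => // /eqP ji.
by rewrite eq_sym (negPf ji) addn0.
Qed.

Lemma setm_addU_neq i j t a : j != i ->
  setm i t (a + U_(j))%MM = (setm i t a + U_(j))%MM.
Proof.
move=> ji; apply/mnmP => k; rewrite !mnmE; case: eqP => // ->.
by rewrite (negPf ji) addn0.
Qed.

(* Induction on the number [d] of coordinates [f] depends on: the last one is
   removed by taking the union of [f] along it. *)
Lemma mnm_stabilises d f : (forall a, C (f a)) -> mnm_mono f ->
    (forall a b, (forall i : 'I_n, (i < d)%N -> a i = b i) -> f a = f b) ->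
  exists N, mnm_stable N f.
Proof.
elim: d f => [|d IH] f Cf fU fd.
  by exists 0%N => a i t _; rewrite (fd (a + U_(i))%MM a).
have [dn|nd] := ltnP d n; last first.
  by apply: IH => // a b ab; apply: fd => i _; apply: ab; apply: leq_trans nd.
pose i0 := Ordinal dn.
(* The slices of [f] along the last coordinate and their union; both depend only on the coordinates
   below [d]. *)
pose f' k a := f (setm i0 k a); pose g a t := exists k, f' k a t.
have f'd k a b : (forall i : 'I_n, (i < d)%N -> a i = b i) -> f' k a = f' k b.
  move=> ab; apply: fd => i; rewrite ltnS !mnmE leq_eqVlt.
  have [//|ii0] := eqVneq i i0; case/orP => [/eqP id|/ab//].
  by case/eqP: ii0; apply: val_inj.
have f'U k : mnm_mono (f' k).
  move=> a j t; rewrite /f'; have [->|ji] := eqVneq j i0; first by rewrite setm_addU.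
  by rewrite setm_addU_neq //; apply: fU.
have f'S k a t : f' k a t -> f' k.+1 a t by rewrite /f' setmS; apply: fU.
have f'C k a : C (f' k a) by apply: Cf.
have ch a := chain (fun k => f'C k a) (fun k => @f'S k a).
have [N0 gN0] : exists N, mnm_stable N g.
  apply: IH => [a|a i t [k fk]|a b ab]; first by have [] := ch a.
    by exists k; apply: f'U.
  apply/funext => t; apply/propext.
  by split=> -[k fk]; exists k; move: fk; rewrite (f'd k a b ab).
have /boolp.choice[K KP] (h : {ffun 'I_n -> 'I_N0.+1}) :
    exists K, forall k t, f' k [multinom h i : nat | i < n] t ->
      f' K [multinom h i : nat | i < n] t by have [] := ch [multinom h i : nat | i < n].
have /boolp.choice[N' N'P] k : exists N, mnm_stable N (f' k).
  exact: IH (f'C k) (f'U k) (f'd k).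
(* At height [T0] the slices have reached their union at every point of the box [[0, N0]^n]. Below
   that height there are finitely many slices, each with its own bound [N' k]. *)
pose T0 := \max_h K h.
exists (maxn N0 (maxn T0 (\max_(k < T0) N' k))) => a i t.
rewrite !geq_max => /and3P[N0a T0a N'a] fa.
have [Ta|aT] := leqP T0 (a i0); last first.
  have ii0 : i != i0 by apply: contraTneq aT => <-; rewrite -leqNgt.
  have := N'P (a i0) a i t; rewrite /f' setm_addU_neq // setm_id; apply=> //.
  by apply: leq_trans N'a; apply: (leq_bigmax (Ordinal aT)).
(* At height [T0] or above: lower the coordinate in the union, clamp into the box, land in the slice
   [K h], and climb back to [a] by monotonicity. *)
have ga : g a t.
  by apply: (gN0 a i) => //; exists ((a + U_(i))%MM i0); rewrite /f' setm_id.
have [k] := stable_clamp gN0 ga.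
pose h : {ffun 'I_n -> 'I_N0.+1} := [ffun j => inord (minn N0 (a j))].
have -> : clamp N0 a = [multinom h j : nat | j < n].
  by apply/mnmP => j; rewrite !mnmE ffunE inordK // ltnS geq_minl.
move=> /KP; rewrite /f'; set c := setm i0 _ _ => fK.
apply: (mnm_mono_le (a := c)) fK => // j; rewrite mnmE.
have [->|_] := eqVneq j i0; first exact: (leq_trans (leq_bigmax (F := K) h) Ta).
by rewrite mnmE ffunE inordK ?ltnS ?geq_minl // geq_minr.
Qed.

End Stabilisation.

(** The union is finitely generated, and its generators all lie in one [W K]. The identity morphism
    serves as [iota]. *)
Lemma rV_chain (R : pzRingType) (k : nat) (W : nat -> 'rV[R]_k -> Prop) :
    left_noetherian R -> (forall i, submodule (W i)) ->
    (forall i v, W i v -> W i.+1 v) ->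
  submodule (fun v => exists i, W i v) /\ exists K, forall i v, W i v -> W K v.
Proof.
move=> hnoeth hW WS.
have Wle i j v : (i <= j)%N -> W i v -> W j v.
  by move=> /subnK <- Wv; elim: (j - i)%N => // d; apply: WS.
have hU : submodule (fun v => exists i, W i v).
  split; first by exists 0%N; have [] := hW 0%N.
    move=> u v [i Wu] [j Wv]; exists (maxn i j); have [_ WD _] := hW (maxn i j).
    by apply: WD; [apply: Wle Wu; apply: leq_maxl | apply: Wle Wv; apply: leq_maxr].
  by move=> r v [i Wv]; exists i; have [_ _ WZ] := hW i; apply: WZ.
split=> //.
have [s [sW sP]] : exists s : seq 'rV[R]_k, (forall y, y \in s -> exists i, W i y) /\
    (forall v, (exists i, W i v) -> rspan (idfun : {rmorphism R -> R}) (fun y => y \in s) v).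
  apply: (@rfingen_noetherian R R (idfun : {rmorphism R -> R}) _ hnoeth _ hU).
  exists [seq delta_mx 0 j | j <- enum 'I_k] => v _; rewrite (row_sum_delta v).
  apply: rsubmodule_sum; first exact: rspan_submodule.
  move=> j; rewrite -[_ *: _]addr0; apply: rspan_step; last exact: rspan0.
  by apply/mapP; exists j; rewrite ?mem_enum.
have [K KP] : exists K, forall y, y \in s -> W K y.
  elim: s sW {sP} => [|y s IH] sW; first by exists 0%N.
  have [i Wy] := sW y (mem_head _ _).
  have [|K KP] := IH; first by move=> z zs; apply: sW; rewrite inE zs orbT.
  exists (maxn i K) => z; rewrite inE => /orP[/eqP->|/KP].
    by apply: Wle Wy; apply: leq_maxl.
  by apply: Wle; apply: leq_maxr.
exists K => i v Wv.
apply: (@rspan_sub R R (idfun : {rmorphism R -> R}) _ _ (W K) (hW K) KP).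
by apply: sP; exists i.
Qed.

(** * The filtration induced by a finite generating family *)

Section GoodFiltration.

Variables (R A : pzRingType) (iota : {rmorphism R -> A}).
Variables (n : nat) (x : 'I_n -> A).
Hypothesis hA : bijective_skew_pbw_extension iota x.
Hypothesis hnoeth : left_noetherian R.
Local Notation mnm := 'X_{1..n}.
Local Notation mon := (mon x).
Local Notation sp_le := (sp_le iota x).
Local Notation sp_lt := (sp_lt iota x).
Implicit Types (a b : mnm).

Variables (M : lmodType A) (k : nat) (g : 'I_k -> M).
Hypothesis g_surj : surj (lincomb g).

Let E_le a (w : 'rV[A]_k) := free_le iota x (fun _ => 0%MM) a w.
Let E_lt a (w : 'rV[A]_k) := free_lt iota x (fun _ => 0%MM) a w.
Let pi := mk_linear (lincomb_linear g).
Let F a v := exists2 w, E_le a w & pi w = v.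
Let G a v := exists2 w, E_lt a w & pi w = v.

Let hE : filtered iota x 0 E_le E_lt.
Proof. by apply: (free_filtered hA) => j i; rewrite mnm0E. Qed.

Lemma image_submodule (M1 M2 : lmodType A) (f : {linear M1 -> M2}) W :
  rsubmodule iota W -> rsubmodule iota (fun v => exists2 w, W w & f w = v).
Proof.
move=> [W0 WD WZ]; split; first by exists 0; rewrite ?linear0.
  by move=> _ _ [u Wu <-] [v Wv <-]; exists (u + v); rewrite ?linearD //; apply: WD.
by move=> r _ [v Wv <-]; exists (iota r *: v); rewrite ?linearZ //; apply: WZ.
Qed.

Let hF a : rsubmodule iota (F a).
Proof. exact/image_submodule/(fil_sub hE). Qed.

Let hG a : rsubmodule iota (G a).
Proof. exact/image_submodule/(gil_sub hE). Qed.

Let G_sum a (c : 'I_k -> A) :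
  (forall j, sp_lt 0%MM a (c j)) -> G a (\sum_j c j *: g j).
Proof.
move=> hc; exists (\row_j c j) => [j|]; first by rewrite mxE.
by apply: eq_bigr => j _; rewrite mxE.
Qed.

(** Coefficients stand to the right of the monomial, so left multiplication by [x i] leaves [r]
    alone. The relations in different degrees thus become comparable submodules of one R^k. *)
Let lead a (r : 'rV[R]_k) : M := \sum_j (mon a * iota (r 0 j)) *: g j.

Let gil_xE a i v : G a v -> G (a + U_(i))%MM (x i *: v).
Proof.
by move=> [w Gw <-]; exists (x i *: w); [apply: (gil_x hE) | rewrite linearZ].
Qed.

Lemma sp_lt_mul_scalar b a c r : sp_lt b a c -> sp_lt b a (c * iota r).
Proof.
apply: mspan_mul_scalar => // m m' mb mm'; apply: lt_trans mb.
by apply: lt_mdeg_ltmc; rewrite !mdegD ltn_add2r.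
Qed.

Let lead_mul_x a i r :
  G (a + U_(i))%MM (x i *: lead a r) <-> G (a + U_(i))%MM (lead (a + U_(i))%MM r).
Proof.
have [u [u' [u'u uu']] uP] := mul_x_mon hA i a.
have [_ GD GZ] := hG (a + U_(i))%MM.
have low : G (a + U_(i))%MM (x i *: lead a r - iota u *: lead (a + U_(i))%MM r).
  rewrite /lead !scaler_sumr -sumrB.
  under eq_bigr => j _ do rewrite !scalerA -scalerBl !mulrA -mulrBl.
  apply: G_sum => j; apply: sp_lt_mul_scalar; apply: mspan_mono uP => m.
  by rewrite /deg_lt addm0 => ma; apply: lt_mdeg_ltmc; rewrite mdegD mdeg1 addn1.
split=> [Gx|Gl]; last by rewrite -[_ *: _](subrK (iota u *: lead (a + U_(i))%MM r)); apply/GD/GZ.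
have := GZ u' _ (rsubmoduleB (hG _) Gx low).
by rewrite opprB addrC subrK scalerA -rmorphM u'u rmorph1 scale1r.
Qed.

(** A scalar [c] acting on [r] crosses [mon a] as [t c], up to lower terms, which lie in [G a]. *)
Let lead_submodule a : submodule (fun r => G a (lead a r)).
Proof.
have [G0 GD GZ] := hG a; split.
- rewrite /lead big1 // => j _; rewrite mxE rmorph0 mulr0.
  exact: scale0r.
- move=> r r' Gr Gr'; have -> : lead a (r + r') = lead a r + lead a r'.
    by rewrite -big_split; apply: eq_bigr => j _; rewrite mxE rmorphD mulrDr scalerDl.
  exact: GD.
- move=> c r Gr; have [t _ tP] := mon_mul_scalar hA a.
  have -> : lead a (c *: r) = iota (t c) *: lead a r +
      \sum_j ((mon a * iota c - iota (t c) * mon a) * iota (r 0 j)) *: g j.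
    rewrite scaler_sumr -big_split; apply: eq_bigr => j _ /=.
    rewrite mxE rmorphM mulrA mulrBl scalerBl scalerA [iota (t c) * (_ * _)]mulrA.
    by rewrite addrC subrK.
  apply: GD; first exact: GZ.
  apply: G_sum => j; apply: sp_lt_mul_scalar; apply: mspan_mono (tP c) => m.
  by rewrite addm0; apply: lt_mdeg_ltmc.
Qed.

(** Bijectivity of [t] turns the leading coefficient on the left of [mon a] into one on the
    right. *)
Let F_lead a v : F a v -> exists r, G a (v - lead a r).
Proof.
move=> [w Fw <-]; have [t [[t' t'K tK] _] tP] := mon_mul_scalar hA a.
have /boolp.choice[r rP] j : exists r, sp_lt 0%MM a (w 0 j - mon a * iota r).
  have [r rP] : exists r, sp_lt 0%MM a (w 0 j - iota r * mon a).
    apply: mspan_lead (Fw j) => m; rewrite addm0 le_eqVlt.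
    by case/orP => [/eqP|]; [left | right].
  exists (t' r); have low : sp_lt 0%MM a (mon a * iota (t' r) - iota r * mon a).
    rewrite -{2}[r]tK; apply: mspan_mono (tP (t' r)) => m.
    by rewrite addm0; apply: lt_mdeg_ltmc.
  by have := aspanB rP low; rewrite opprB addrA subrK.
exists (\row_j r j); rewrite /= /lincomb /lead -sumrB.
under eq_bigr => j _ do rewrite mxE -scalerBl.
exact: G_sum.
Qed.

(** The submodules of those [r] with [lead a r] in [G a] grow with [a], hence stabilise from some
    [N] on; this is graded injectivity of [x i]. Graded surjectivity is inherited from the free
    module in all degrees. *)
Lemma good_filtration_ex : exists N, filtered iota x N F G.
Proof.
have [N LN] : exists N, mnm_stable N (fun a r => G a (lead a r)).
  apply: (@mnm_stabilises n _ (@submodule R 'rV[R]_k) _ n) => [W hW WS|a|a i r Gr|a b ab].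
  - exact: rV_chain.
  - exact: lead_submodule.
  - exact/lead_mul_x/gil_xE.
  - by have -> : a = b by apply/mnmP => i; apply: ab.
exists N; split=> //.
- by move=> a v [w Gw <-]; exists w => //; apply: (gil_le hE).
- by move=> a b v ab [w Fw <-]; exists w => //; apply: (fil_lt hE ab).
- move=> v; have [w wv] := g_surj v; have [a Fw] := fil_exh hE w.
  by exists a, w.
- move=> a v [w Gw <-]; case: (gil_low hE Gw) => [->|[b ba Fb]].
    by left; rewrite linear0.
  by right; exists b => //; exists w.
- by move=> a i v [w Fw <-]; exists (x i *: w); rewrite ?linearZ //; apply: (fil_x hE).
- move=> a i v Na Fv Gxv; have [r Gr] := F_lead Fv.
  have [_ GD _] := hG a; rewrite -[v](subrK (lead a r)); apply: GD => //.
  apply: LN Na _; apply/lead_mul_x.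
  have := rsubmoduleB (hG _) Gxv (gil_xE i Gr).
  by rewrite scalerBr opprB addrC subrK.
- move=> a i v Na [w Fw <-]; have [u Fu Gu] := fil_surj hE (leq0n (a i)) Fw.
  exists (pi u); first by exists u.
  by exists (w - x i *: u); [exact: Gu | rewrite linearB linearZ].
- by move=> a; apply: (rfingen_image (f := pi)) (fil_fg hE a) => v; apply.
Qed.

End GoodFiltration.

(** * Descent along the box *)

Section FunCat.

Variables (T : Type) (m1 m2 : nat) (f1 : 'I_m1 -> T) (f2 : 'I_m2 -> T).

Definition fcat (j : 'I_(m1 + m2)) : T :=
  match split j with inl i => f1 i | inr i => f2 i end.

Lemma fcatl i : fcat (lshift m2 i) = f1 i.
Proof. by rewrite /fcat (unsplitK (inl i)). Qed.

Lemma fcatr i : fcat (rshift m1 i) = f2 i.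
Proof. by rewrite /fcat (unsplitK (inr i)). Qed.

Lemma fcatP (P : T -> Prop) :
  (forall i, P (f1 i)) -> (forall i, P (f2 i)) -> forall j, P (fcat j).
Proof. by move=> P1 P2 j; rewrite /fcat; case: (split j). Qed.

End FunCat.

Section Descent.

Variables (R A : pzRingType) (iota : {rmorphism R -> A}).
Variables (n : nat) (x : 'I_n -> A).
Hypothesis hA : bijective_skew_pbw_extension iota x.
Hypothesis hnoeth : left_noetherian R.
Local Notation mnm := 'X_{1..n}.
Local Notation mon := (mon x).
Local Notation sp_le := (sp_le iota x).
Local Notation sp_lt := (sp_lt iota x).
Local Notation filtered := (filtered iota x).
Implicit Types (a b : mnm).

Lemma iota_inj : injective iota.
Proof. by have [[]] := hA. Qed.

Lemma sp_le_eq0 b a c : (a < b)%O -> sp_le b a c -> c = 0.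
Proof.
move=> ab; elim/aspan_ind=> // r _ c' [m mb ->]; have := lt_le_trans ab (lemc_addl m b).
by rewrite ltNge mb.
Qed.

Lemma sp_le_iota b r : sp_le b b (iota r).
Proof.
rewrite -[iota r]mulr1 -(mon0 x); apply/aspanZ/mspan_mon.
by rewrite add0m.
Qed.

Lemma sp_le_refl b c : sp_le b b c -> exists r, c = iota r.
Proof.
elim/aspan_ind=> [|r _ c' [m mb ->] _ [s ->]]; first by exists 0; rewrite rmorph0.
suff -> : m = 0%MM by exists (r + s); rewrite mon0 mulr1 rmorphD.
move: mb; rewrite -{2}[b]add0m lemc_add2l => m0.
by apply/eqP; rewrite eq_le m0 le0x.
Qed.

Variable N : nat.

(* Degrees outside the box [[0, N]^n] are reached from smaller ones by
   multiplication by some [x i], up to lower degree. *)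
Lemma box_ind (P : mnm -> Prop) :
    (forall a, (forall i, a i <= N)%N -> (forall b, (b < a)%O -> P b) -> P a) ->
    (forall a i, (N <= a i)%N -> (forall b, (b < (a + U_(i))%MM)%O -> P b) ->
      P (a + U_(i))%MM) ->
  forall a, P a.
Proof.
move=> Pbox PU; apply: ltmwf => a IH.
have [/existsP[i ai]|] := boolP [exists i, (N < a i)%N]; last first.
  by rewrite negb_exists => /forallP aN; apply: Pbox => // i; rewrite leqNgt.
have ai0 : (0 < a i)%N by apply: leq_ltn_trans ai.
rewrite -(mnm_subUK ai0); apply: PU; last by rewrite (mnm_subUK ai0).
by rewrite mnmBE mnm1E eqxx subn1 -ltnS prednK.
Qed.

Lemma addU_gt a i : (a < (a + U_(i))%MM)%O.
Proof. by apply: lt_mdeg_ltmc; rewrite mdegD mdeg1 addn1. Qed.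

Lemma fil_eq0 (M : lmodType A) (F G : mnm -> M -> Prop) : filtered N F G ->
  (forall a, (forall i, a i <= N)%N -> forall v, F a v -> v = 0) ->
  forall v : M, v = 0.
Proof.
move=> hF F0 v; have [a] := fil_exh hF v; move: v.
elim/box_ind: a => [a aN _|a i Na IH] v Fv; first exact: F0 Fv.
have [u Fu Gu] := fil_surj hF Na Fv; move: Gu.
rewrite (IH _ (addU_gt a i) _ Fu) scaler0 subr0.
by case/(gil_low hF) => // -[b ba /IH]; apply.
Qed.

(** Sorted without repetition, so that splitting the list at [b] separates the smaller degrees from
    the larger ones. *)
Definition box : seq mnm :=
  sort <=%O (undup [seq [multinom h i : nat | i < n] | h : {ffun 'I_n -> 'I_N.+1}]).

Lemma mem_box a : (a \in box) = [forall i, (a i <= N)%N].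
Proof.
rewrite mem_sort mem_undup; apply/mapP/forallP => [[h _ -> i]|aN].
  by rewrite mnmE -ltnS.
exists [ffun i => inord (a i)]; first by rewrite mem_enum.
by apply/mnmP => i; rewrite mnmE ffunE inordK ?ltnS.
Qed.

Lemma box_lt_sorted : sorted <%O box.
Proof. by rewrite sort_lt_sorted undup_uniq. Qed.

Definition null_on (s : seq mnm) (M : lmodType A) (F : mnm -> M -> Prop) : Prop :=
  forall a, a \in s -> forall v, F a v -> v = 0.

(** An element of degree [a] in [s] is written with generators placed exactly in degree [a]; this
    makes the resulting cover strict. *)
Lemma fil_generators (M : lmodType A) (F G : mnm -> M -> Prop) (s : seq mnm) :
    filtered N F G ->
  exists (m : nat) (sh : 'I_m -> mnm) (g : 'I_m -> M),
    (forall j, sh j \in s /\ F (sh j) (g j)) /\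
    forall a, a \in s -> forall v, F a v -> exists c : 'I_m -> R,
      v = \sum_j iota (c j) *: g j /\ forall j, c j = 0 \/ sh j = a.
Proof.
move=> hF; elim: s => [|b s [m [sh [g [shg gP]]]]].
  exists 0%N, (fun _ => 0%MM), (fun _ => 0); split=> [[]|] //.
have [l [lF lP]] := rfingen_noetherian hnoeth (fil_sub hF b) (fil_fg hF b).
exists (size l + m)%N, (fcat (fun _ => b) sh), (fcat (fun j : 'I_(size l) => l`_j) g).
split=> [j|a].
  rewrite /fcat; case: (split j) => i; first by rewrite mem_head; split=> //; apply/lF/mem_nth.
  by have [shs Fg] := shg i; rewrite inE shs orbT.
rewrite inE => ab v Fv; have [e|ane] := eqVneq a b.
  rewrite e in Fv *; have [c ->] := rspan_seq (lP v Fv).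
  exists (fcat c (fun _ => 0)); split=> [|j].
    rewrite big_split_ord /= [X in _ + X]big1 ?addr0 => [|i _]; last first.
      by rewrite !fcatr rmorph0 scale0r.
    by apply: eq_bigr => i _; rewrite !fcatl.
  by rewrite /fcat; case: (split j) => i; [right | left].
move: ab; rewrite (negPf ane) => as_; have [c [-> cP]] := gP a as_ v Fv.
exists (fcat (fun _ => 0) c); split=> [|j].
  rewrite big_split_ord /= [X in X + _]big1 ?add0r => [|i _]; last first.
    by rewrite !fcatl rmorph0 scale0r.
  by apply: eq_bigr => i _; rewrite !fcatr.
by rewrite /fcat; case: (split j) => i; [left | apply: cP].
Qed.

(** * Eliminating one degree [b] of the box *)

Section Syzygy.

Variables (s1 s2 : seq mnm) (b : mnm).
Hypothesis boxE : box = s1 ++ b :: s2.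

Lemma box_lt : (forall a, a \in s1 -> (a < b)%O) /\
  (forall a, a \in s2 -> (b < a)%O).
Proof.
have := box_lt_sorted; rewrite boxE sorted_pairwise; last exact: lt_trans.
rewrite pairwise_cat /= => /and3P[/allrelP s1s _ /andP[/allP bs _]].
by split=> a ha; [apply: s1s; rewrite ?mem_head | apply: bs].
Qed.

(* Cover [M] by a filtered free module, using the prescribed generators [g0]
   in degree [b].  The kernel [K] still vanishes on [s1], and its part of
   degree [b] consists of the [R]-relations between the [g0]. *)
Lemma filtered_syzygy (M : lmodType A) (F G : mnm -> M -> Prop)
    (t : nat) (g0 : 'I_t -> M) :
    filtered N F G -> null_on s1 F -> (forall k, F b (g0 k)) ->
    (forall v, F b v -> exists c : 'I_t -> R, v = \sum_k iota (c k) *: g0 k) ->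
  exists (K : lmodType A) (F' G' : mnm -> K -> Prop),
    [/\ filtered N F' G', null_on s1 F', sfree_if_proj K -> sfree_if_proj M
      & exists rho : K -> 'rV[R]_t,
        [/\ forall r u v, F' b u -> F' b v ->
              rho (iota r *: u + v) = r *: rho u + rho v,
            forall u, F' b u -> rho u = 0 -> u = 0,
            forall u, F' b u -> \sum_k iota (rho u 0 k) *: g0 k = 0
          & forall c : 'rV[R]_t, \sum_k iota (c 0 k) *: g0 k = 0 ->
              exists2 u, F' b u & rho u = c]].
Proof.
move=> hF F0 Fg0 g0P; have [lt1 lt2] := box_lt.
have [m [sh [g1 [shg g1P]]]] := fil_generators s2 hF.
pose shift := fcat (fun _ : 'I_t => b) sh; pose g := fcat g0 g1.
have sh_box j : shift j \in box.
  rewrite boxE mem_cat; apply/orP; right; rewrite /shift.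
  apply: (fcatP (P := fun a => a \in b :: s2)) => i; first exact: mem_head.
  by rewrite inE; have [-> _] := shg i; rewrite orbT.
have hE : filtered N (free_le iota x shift) (free_lt iota x shift).
  apply: (free_filtered hA) => j i; have := sh_box j.
  by rewrite mem_box => /forallP.
have Fg j : F (shift j) (g j).
  by rewrite /shift /g /fcat; case: (split j) => // i; have [] := shg i.
pose f := mk_linear (lincomb_linear g).
have fF a v : free_le iota x shift a v -> F a (f v).
  move=> Ev; have [f0 fD _] := fil_sub hF a.
  by rewrite /= /lincomb; elim/big_ind: _ => // j _; apply: fil_act hF (Fg j) (Ev j).
have EZ a := fil_sub hE a.
(* Strictness of the cover. In the box, [F] vanishes on [s1], [g0] serves degree [b] and [g1] serves
   [s2]. Outside, write [u] as [x i *: w] plus a term of lower degree and lift both by induction. *)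
have Ff a u : F a u -> exists2 v, free_le iota x shift a v & f v = u.
  elim/box_ind: a u => [a aN _|a i Na IH] u Fu.
    have : a \in box by rewrite mem_box; apply/forallP.
    rewrite boxE mem_cat inE => /or3P[as1|/eqP ab|as2].
    - exists 0; first by have [] := EZ a.
      by rewrite linear0 (F0 a as1 u Fu).
    - rewrite ab in Fu *; have [c ->] := g0P u Fu.
      exists (\row_j iota (fcat c (fun _ => 0) j)) => [j|].
        rewrite mxE /shift /fcat; case: (split j) => k; first exact: sp_le_iota.
        by rewrite rmorph0; apply: aspan0.
      rewrite /= /lincomb big_split_ord /= [X in _ + X]big1 => [|k _]; last first.
        by rewrite mxE fcatr rmorph0 scale0r.
      by rewrite addr0; apply: eq_bigr => k _; rewrite mxE /g !fcatl.
    - have [c [-> cP]] := g1P a as2 u Fu.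
      exists (\row_j iota (fcat (fun _ => 0) c j)) => [j|].
        rewrite mxE /shift /fcat; case: (split j) => k.
          by rewrite rmorph0; apply: aspan0.
        case: (cP k) => [->|->]; first by rewrite rmorph0; apply: aspan0.
        exact: sp_le_iota.
      rewrite /= /lincomb big_split_ord /= [X in X + _]big1 => [|k _]; last first.
        by rewrite mxE fcatl rmorph0 scale0r.
      by rewrite add0r; apply: eq_bigr => k _; rewrite mxE /g !fcatr.
  have [w Fw Gw] := fil_surj hF Na Fu.
  have [w' Ew' fw'] := IH _ (addU_gt a i) _ Fw.
  have [z Ez fz] : exists2 z, free_le iota x shift (a + U_(i))%MM z & f z = u - x i *: w.
    case/(gil_low hF): Gw => [->|[c ca /(IH _ ca)[z Ez fz]]].
      by exists 0; rewrite ?linear0 //; have [] := EZ (a + U_(i))%MM.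
    by exists z => //; apply: (fil_mono hE (ltW ca)).
  exists (x i *: w' + z); last by rewrite linearD linearZ fw' fz addrC subrK.
  by have [_ ED _] := EZ (a + U_(i))%MM; apply: ED => //; apply: (fil_x hE).
have f_surj : surj f by move=> u; have [a /Ff[v _ fv]] := fil_exh hF u; exists v.
exists (kermod f), (fun a k => free_le iota x shift a (val k)),
  (fun a k => free_lt iota x shift a (val k)); split.
- exact: (ker_filtered hnoeth hE hF fF Ff).
- move=> a as1 k Ek; apply: val_inj; apply/rowP => j; rewrite [RHS]mxE.
  apply: (sp_le_eq0 _ (Ek j)); rewrite /shift.
  apply: (fcatP (P := fun c => (a < c)%O)) => i; first exact: lt1.
  by have [/lt2 + _] := shg i; apply: lt_trans; apply: lt1.
- exact: sfree_if_proj_ker.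
(* [iv] is a left inverse of [iota], with default value 0 off its image. *)
have /boolp.choice[iv ivP] c : exists r, forall r', c = iota r' -> r = r'.
  case: (pselect (exists r, c = iota r)) => [[r ->]|no]; last first.
    by exists 0 => r' cr; case: no; exists r'.
  by exists r => r' /iota_inj.
have iotaK r : iv (iota r) = r by apply: ivP.
(* In degree [b] the generators of larger degree contribute nothing, and those of degree [b] carry
   coefficients in [iota R]. *)
have Eb (k : kermod f) : free_le iota x shift b (val k) ->
    val k = row_mx (map_mx iota (\row_j iv ((val k : 'rV_(t + m)) 0 (lshift m j)))) 0.
  move=> Ek; apply/rowP => j; rewrite -(splitK j); case: (split j) => i /=.
    rewrite row_mxEl !mxE; have := Ek (lshift m i).
    by rewrite /shift fcatl => /sp_le_refl[r ->]; rewrite iotaK.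
  rewrite row_mxEr mxE; apply: (sp_le_eq0 _ (Ek (rshift t i))).
  by rewrite /shift fcatr; have [/lt2] := shg i.
have fE (c : 'rV[R]_t) : f (row_mx (map_mx iota c) 0) = \sum_k iota (c 0 k) *: g0 k.
  rewrite /= /lincomb big_split_ord /= [X in _ + X]big1 => [|k _]; last first.
    by rewrite row_mxEr mxE scale0r.
  by rewrite addr0; apply: eq_bigr => k _; rewrite row_mxEl mxE /g fcatl.
exists (fun k : kermod f => \row_j iv ((val k : 'rV_(t + m)) 0 (lshift m j))); split.
- move=> r u v /Eb uE /Eb vE; apply/rowP => j; rewrite !mxE.
  have /rowP/(_ (lshift m j)) := uE; have /rowP/(_ (lshift m j)) := vE.
  rewrite !row_mxEl !mxE => vj uj.
  by apply: ivP; rewrite /= rmorphD rmorphM -uj -vj.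
- move=> u /Eb uE u0; apply: val_inj; rewrite uE u0.
  apply/rowP => j; rewrite -(splitK j); case: (split j) => i /=;
    by rewrite ?row_mxEl ?row_mxEr !mxE ?rmorph0.
- by move=> u /Eb uE; rewrite -fE -uE; apply: (submodP u).
- move=> c c0; have kc : f (row_mx (map_mx iota c) 0) = 0 by rewrite fE.
  exists (submod_elt (ker_submodule f) kc) => [j|].
    rewrite /= -(splitK j); case: (split j) => i /=.
      by rewrite row_mxEl mxE /shift fcatl; apply: sp_le_iota.
    by rewrite row_mxEr mxE; apply: aspan0.
  by apply/rowP => j; rewrite mxE /= row_mxEl mxE iotaK.
Qed.

Hypothesis hpsf : PSF R.

Hypothesis IH : forall (M : lmodType A) (F G : mnm -> M -> Prop),
  filtered N F G -> null_on (rcons s1 b) F -> sfree_if_proj M.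

(** The degree [b] part V is stably free, V + R^s = R^t. Adding A^s in degree [b] to [M] makes this
    part free; covering it by a basis leaves no relation in degree [b], so [IH] applies to the
    kernel. *)
Lemma sfree_proj_degree (M : lmodType A) (F G : mnm -> M -> Prop)
    (hF : filtered N F G) :
  null_on s1 F -> projective (resmod (fil_sub hF b)) -> sfree_if_proj M.
Proof.
move=> F0 prV; have [lt1 _] := box_lt.
have [s [t [f f_bij]]] := hpsf (resmod_fingen (fil_sub hF b) hnoeth (fil_fg hF b)) prV.
have [f' fK f'K] := f_bij.
have [h [hK Kh]] := bij_linear_inv (can_inj fK) (fun w => ex_intro _ (f' w) (f'K w)).
apply: (@sfree_if_proj_prod _ s).
have bN i : (b i <= N)%N.
  have : b \in box by rewrite boxE mem_cat mem_head orbT.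
  by rewrite mem_box => /forallP.
have hF2 := prod_filtered hF (free_filtered hA (fun (_ : 'I_s) i => bN i)).
pose M2 : lmodType A := (M * 'rV[A]_s)%type.
(* The isomorphism of R^t with V + R^s, read inside [M2]; images of the standard basis become the
   generators [g0]. *)
pose psi (q : 'rV[R]_t) : res iota M2 := (val (h q).1, map_mx iota (h q).2).
have lin_psi : linear psi.
  move=> r u v; rewrite /psi linearP; apply/pair_equal_spec; split=> //=.
  by apply/rowP => j; rewrite !mxE rmorphD rmorphM.
have psiE q : psi q = \sum_k iota (q 0 k) *: (psi (delta_mx 0 k) : M2).
  exact: (linear_rV (mk_linear lin_psi) q).
have F2b q : F b (psi q).1 /\ free_le iota x (fun _ => b) b (psi q).2.
  split; first exact: (submodP (h q).1).
  by move=> j; rewrite mxE; apply: sp_le_iota.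
have [||| K [F' [G' [hF' F'0 sK [rho [_ rhoI rho0 _]]]]]] :=
  filtered_syzygy (g0 := fun k => psi (delta_mx 0 k)) hF2.
- move=> a as1 [v w] [/= Fv Ew]; rewrite (F0 a as1 v Fv); congr (_, _).
  by apply/rowP => j; rewrite mxE; apply: sp_le_eq0 (lt1 a as1) (Ew j).
- by move=> k; apply: F2b.
- move=> [v w] [/= Fv Ew].
  have /boolp.choice[r rP] j := sp_le_refl (Ew j).
  pose q := f (submod_elt _ Fv, \row_j r j); exists (fun k => q 0 k).
  rewrite -psiE /psi /q hK /=; congr (_, _).
  by apply/rowP => j; rewrite !mxE.
apply: sK; apply: IH hF' _ => a; rewrite mem_rcons inE => /orP[/eqP->|]; last exact: F'0.
move=> v Fv; apply: rhoI => //; have := rho0 v Fv.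
rewrite -psiE => -[h1 h2]; apply: (can_inj Kh); rewrite linear0.
rewrite [LHS]surjective_pairing; apply/pair_equal_spec; split.
  exact: val_inj.
apply/rowP => j; apply: iota_inj; move/rowP/(_ j): h2.
by rewrite !mxE rmorph0.
Qed.

(** Induction on [d]: replacing [M] by a filtered syzygy replaces its degree [b] part by a syzygy
    over [R], which lowers the bound on projective dimension by one. *)
Lemma sfree_pdim_degree d (M : lmodType A) (F G : mnm -> M -> Prop)
    (hF : filtered N F G) :
  null_on s1 F -> pdim_le d (resmod (fil_sub hF b)) -> sfree_if_proj M.
Proof.
elim: d M F G hF => [|d IHd] M F G hF F0 pdV; first exact: sfree_proj_degree F0 pdV.
have [l [lF lP]] := rfingen_noetherian hnoeth (fil_sub hF b) (fil_fg hF b).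
have lF' (k : 'I_(size l)) : F b l`_k by apply/lF/mem_nth.
have [K [F' [G' [hF' F'0 sK [rho [rhoD rhoI rho0 rhoS]]]]]] :=
  filtered_syzygy hF F0 lF' (fun v Fv => rspan_seq (lP v Fv)).
apply: sK; apply: (IHd _ _ _ hF') => //.
pose V := resmod (fil_sub hF b); pose V' := resmod (fil_sub hF' b).
have lin_i : linear (fun u : V' => rho (val u)).
  by move=> r u v; rewrite -rhoD //; apply: submodP.
pose e (k : 'I_(size l)) : V := submod_elt (res_submodule (fil_sub hF b)) (lF' k).
have eE c : val (lincomb e c) = \sum_k iota (c 0 k) *: l`_k :> M.
  exact: (raddf_sum (val : {additive V -> res iota M})).
apply: (@pdim_le_syzygy _ _ _ _ _ (mk_linear lin_i)
  (mk_linear (lincomb_linear e)) _ _ _ _ pdV).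
- exact: projective_rV.
- move=> u u' uu'; apply/eqP; rewrite -subr_eq0; apply/eqP/val_inj.
  apply: rhoI; first exact: (submodP (u - u')).
  by rewrite -[LHS]/(mk_linear lin_i (u - u')) linearB uu' subrr.
- move=> c; split=> [/(congr1 val)|[u <-]].
    rewrite [X in X = _]eE => /rhoS[u Fu uc].
    by exists (submod_elt (res_submodule (fil_sub hF' b)) Fu).
  by apply: val_inj; rewrite [LHS]eE; apply: rho0; apply: (submodP u).
- move=> v; have [c vE] := rspan_seq (lP _ (submodP v)).
  exists (\row_k c k); apply: val_inj; rewrite [LHS]eE [RHS]vE.
  by apply: eq_bigr => k _; rewrite mxE.
Qed.

End Syzygy.

Hypothesis hreg : left_regular R.
Hypothesis hpsf : PSF R.

(** Induction on the remaining part [s2] of the box. Regularity bounds the projective dimension of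
    the next degree, which is finitely generated over [R]. *)
Lemma filtered_sfree_if_proj (s1 s2 : seq mnm) (M : lmodType A)
    (F G : mnm -> M -> Prop) : box = s1 ++ s2 ->
  filtered N F G -> null_on s1 F -> sfree_if_proj M.
Proof.
elim: s2 s1 M F G => [|b s2 IH] s1 M F G boxE hF F0.
  move=> _; apply: stably_free_zero; apply: (fil_eq0 hF) => a aN; apply: F0.
  by rewrite -[s1]cats0 -boxE mem_box; apply/forallP.
have [d /projdim_le_pdim_le pdV] :=
  hreg (resmod_fingen (fil_sub hF b) hnoeth (fil_fg hF b)).
apply: (sfree_pdim_degree boxE hpsf _ F0 pdV) => M' F' G'.
by apply: IH; rewrite cat_rcons.
Qed.

End Descent.

Theorem corollary2p8 (R A : pzRingType) (iota : {rmorphism R -> A})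
    (n : nat) (x : 'I_n -> A)
    (hA : bijective_skew_pbw_extension iota x)
    (hnoeth : left_noetherian R) (hreg : left_regular R) (hpsf : PSF R) :
  PSF A.
Proof.
move=> P [k [g gP]]; have g_surj : surj (lincomb g).
  move=> v; have [c ->] := gP v; exists (\row_j c j).
  by apply: eq_bigr => j _; rewrite mxE.
have [N hF] := good_filtration_ex hA hnoeth g_surj.
(* The descent starts with the whole box ahead, so the vanishing condition is empty. *)
exact: (filtered_sfree_if_proj hA hnoeth hreg hpsf (s1 := [::]) (erefl _) hF).
Qed.
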